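(* Let $N\in\mathbb{Z}_{\ge1}$. There exists a compact region $P_N\subset\mathbb{C}$ such that for every $\delta>0$ the root sets $$\mathfrak{R}_n^{[N]}=\left\{x\in\mathbb{C}:\ \mathcal{Q}_n^{[N]}\big(n^{\frac{2N}{2N+1}}x\big)=0\right\}$$ are contained in the $\delta$-neighborhood of $P_N$ for all sufficiently large $n$.
   Context: Lenard operators: the differential polynomials $\mathcal{L}_k[u]$ are defined by $\frac{d}{dx}\mathcal{L}_{k+1}[u]=\left(\frac{d^3}{dx^3}+4u\frac{d}{dx}+2u_x\right)\mathcal{L}_k[u]$ for $k\ge 0$, $\mathcal{L}_0[u]=\frac12$, with the integration constants fixed by $\mathcal{L}_k[0]=0$ for $k\ge1$. Higher Vorob'ev-Yablonski polynomials: $\mathcal{Q}_n^{[N]}(x)$ is the generalized Vorob'ev-Yablonski polynomial with all parameters $t_3=t_5=\cdots=t_{2N-1}=0$, that is, $\mathcal{Q}_0^{[N]}(x)=1$, $\mathcal{Q}_1^{[N]}(x)=x$ and for $n\ge1$ $$\mathcal{Q}_{n+1}^{[N]}(x)\mathcal{Q}_{n-1}^{[N]}(x)=\big(\mathcal{Q}_n^{[N]}(x)\big)^2\Big\{x-2\mathcal{L}_N\Big[2\tfrac{d^2}{dx^2}\ln\mathcal{Q}_n^{[N]}(x)\Big]\Big\}.$$ *)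

(* Defs.v *)
From HB Require Import structures.
From mathcomp Require Import all_boot all_order all_algebra.
From mathcomp Require Import complex.
From mathcomp Require Import all_classical all_reals all_analysis.

Set Implicit Arguments.
Unset Strict Implicit.
Unset Printing Implicit Defensive.

Import Order.TTheory GRing.Theory Num.Theory.
Import numFieldNormedType.Exports.

Local Open Scope classical_set_scope.
Local Open Scope complex_scope.
Local Open Scope ring_scope.

(* Packing R[i] as a numClosedFieldType gives it the topology and the complex
   derivative that MathComp-Analysis attaches to every numFieldType; norms and
   radii of balls are then elements of Cplx R itself. *)
Definition Cplx (R : realType) : numClosedFieldType := R[i].

Definition toC (R : realType) (r : R) : Cplx R := r%:C.

(* Expressions for the elements of K[u, u_x, u_xx, ...]; Dvar j stands for the
   j-th derivative of u. *)
Inductive dpoly (K : Type) : Type :=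
  | Dconst of K
  | Dvar of nat
  | Dadd of dpoly K & dpoly K
  | Dmul of dpoly K & dpoly K.

Arguments Dvar {K} _.

(* The total derivative d/dx. *)
Fixpoint Dx (K : nzRingType) (p : dpoly K) : dpoly K :=
  match p with
  | Dconst _ => Dconst 0
  | Dvar j => Dvar j.+1
  | Dadd p q => Dadd (Dx p) (Dx q)
  | Dmul p q => Dadd (Dmul (Dx p) q) (Dmul p (Dx q))
  end.

(* The value at u = s 0, u_x = s 1, u_xx = s 2, ... *)
Fixpoint jet_eval (K : nzRingType) (s : nat -> K) (p : dpoly K) : K :=
  match p with
  | Dconst c => c
  | Dvar j => s j
  | Dadd p q => jet_eval s p + jet_eval s q
  | Dmul p q => jet_eval s p * jet_eval s q
  end.

Definition dpoly_eval (K : numFieldType) (p : dpoly K) (u : K -> K) : K -> K :=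
  fun x => jet_eval (fun j => derive1n j u x) p.

(* Identities between differential polynomials are stated at all jets s: over
   an infinite field a polynomial is determined by its values. *)
Definition is_lenard (K : numFieldType) (L : nat -> dpoly K) : Prop :=
  [/\ forall s : nat -> K, jet_eval s (L 0%N) = 2^-1,
      forall (k : nat) (s : nat -> K),
        jet_eval s (Dx (L k.+1)) =
          jet_eval s (Dx (Dx (Dx (L k)))) + 4 * s 0%N * jet_eval s (Dx (L k))
          + 2 * s 1%N * jet_eval s (L k)
    & forall k : nat, (1 <= k)%N -> jet_eval (fun=> 0) (L k) = 0].

(* d/dx ln q is the single-valued function q'/q; it is meaningful where
   q.[x] != 0. *)
Definition log_deriv (K : numFieldType) (q : {poly K}) : K -> K :=
  fun x => (deriv q).[x] / q.[x].

Definition VY_potential (K : numFieldType) (q : {poly K}) : K -> K :=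
  fun x => 2 * derive1 (log_deriv q) x.

(* The recursion is an identity of rational functions, asserted where
   ln Q_n is defined. *)
Definition is_higher_VY (K : numFieldType) (N : nat) (L : nat -> dpoly K)
    (Q : nat -> {poly K}) : Prop :=
  [/\ Q 0%N = 1, Q 1%N = 'X
    & forall (n : nat) (x : K), (1 <= n)%N -> (Q n).[x] != 0 ->
        (Q n.+1).[x] * (Q n.-1).[x] =
          (Q n).[x] ^+ 2 *
          (x - 2 * dpoly_eval (L N) (VY_potential (Q n)) x)].

Definition scaled_roots (R : realType) (N : nat) (Q : nat -> {poly Cplx R})
    (n : nat) : set (Cplx R) :=
  [set x | root (Q n) (toC (n%:R `^ (N.*2%:R / N.*2.+1%:R)) * x)].

(* A compact region is a compact set that is the closure of a domain. *)
Definition compact_region (T : topologicalType) (P : set T) : Prop :=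
  compact P /\
  exists O : set T, [/\ open O, connected O, O !=set0 & P = closure O].

Definition nbhd_of (R : realType) (P : set (Cplx R)) (delta : R) :
    set (Cplx R) :=
  [set x | exists2 y, P y & `|x - y| < toC delta].

(* Main.v *)
Require Import Defs.
From HB Require Import structures.
From mathcomp Require Import all_boot all_order all_algebra.
From mathcomp Require Import complex zify ring lra.
From mathcomp Require Import all_classical all_reals all_analysis.

Import Order.TTheory GRing.Theory Num.Theory.
Import numFieldNormedType.Exports.

Local Open Scope classical_set_scope.
Local Open Scope ring_scope.

(* Proof idea. It suffices to bound the scaled roots uniformly: the closure of
   a large disk is then a suitable region. Fix a point x <> 0, let u_n be the
   potential 2 (ln Q_n)'', and read the recursion as
     u_(n+1) - 2 u_n + u_(n-1) = 2 (ln (x - 2 L_N[u_n]))''.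
   This is a discrete evolution equation in n, to which a Cauchy-Kovalevskaya
   argument applies. As long as n <= M, every derivative of u_n at x is bounded
   by that of an explicit majorant of size M^2 / |x|^2 whose second difference
   in n dominates the right-hand side as soon as M^(2N) / |x|^(2N+1) is small.
   In particular |2 L_N[u_n](x)| < |x|, and the recursion propagates
   Q_n(x) <> 0 up to n = M. *)

(** * Leibniz products of sequences of derivatives *)

(** The right-hand side contains derivatives of u_n of higher order than the left, so no bound on
    finitely many derivatives closes up. All derivatives are bounded at once by a sequence of Cauchy
    type whose radius, of order |x|, shrinks by the factor exp(-4/M) at each step, hence by at most
    e^4 in all. With y = (k+2)/M, the k-th term of the majorant grows like exp(4 n y), and its
    second difference in n gains y^2 times an exponential in y. Since the majorant has size
    (M/|x|)^2, the gain y^2 is worth ((k+2)/|x|)^2, which is the price of two derivatives in x; the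
    exponential pays for the polynomial (1+y)^(2N) lost in forming L_N. The smallness condition, and
    with it the exponent 2N/(2N+1), comes from homogeneity: if u has weight 2 and d/dx weight 1,
    then L_N has weight 2N, so it is of order (M/|x|)^(2N), to be compared with x. The Lenard
    recursion determines only the derivative of L_(k+1). A quadratic first integral avoids the
    integration and makes the sizes of the L_k accessible by induction. *)

Definition conv (A : pzRingType) (a b : nat -> A) (n : nat) : A :=
  \sum_(i < n.+1) (a i * b (n - i)%N) *+ 'C(n, i).
Arguments conv {A} a b n.

Lemma conv0 (A : pzRingType) (a b : nat -> A) : conv a b 0 = a 0%N * b 0%N.
Proof. by rewrite /conv big_ord_recl big_ord0 addr0 bin0. Qed.

Lemma convS (A : pzRingType) (a b : nat -> A) n :
  conv a b n.+1 = conv (fun i => a i.+1) b n + conv a (fun i => b i.+1) n.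
Proof.
rewrite /conv big_ord_recl.
under eq_bigr => i _ do rewrite lift0 subSS binS mulrnDr.
rewrite big_split /= addrA [RHS]addrC; congr (_ + _).
have -> : \sum_(i < n.+1) a i * b (n - i).+1 *+ 'C(n, i) =
          \sum_(i < n.+2) a i * b (n.+1 - i)%N *+ 'C(n, i).
  rewrite [RHS]big_ord_recr /= bin_small// mulr0n addr0.
  by apply: eq_bigr => i _; rewrite subSn// -ltnS.
by rewrite [RHS]big_ord_recl !bin0; congr (_ + _).
Qed.

Lemma eq_conv (A : pzRingType) (a a' b b' : nat -> A) n :
  a =1 a' -> b =1 b' -> conv a b n = conv a' b' n.
Proof. by move=> ea eb; apply: eq_bigr => i _; rewrite ea eb. Qed.

Lemma conv_delta (A : pzRingType) (c : A) (a b : nat -> A) n :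
  (forall i, a i = c *+ (i == 0)%N) -> conv a b n = c * b n.
Proof.
move=> ac; rewrite /conv big_ord_recl bin0 subn0 ac mulr1n mulr1n big1 ?addr0// => i _.
by rewrite ac lift0 mulr0n mul0r mul0rn.
Qed.

Lemma convC (A : comPzRingType) (a b : nat -> A) n : conv a b n = conv b a n.
Proof.
rewrite /conv (reindex_inj rev_ord_inj) /=; apply: eq_bigr => i _.
have ein : (i <= n)%N by rewrite -ltnS.
by rewrite subSS subKn// bin_sub// mulrC.
Qed.

Lemma convZ (A : comPzRingType) (c d : A) (a b : nat -> A) n :
  conv (fun i => c * a i) (fun i => d * b i) n = c * d * conv a b n.
Proof. by rewrite /conv mulr_sumr; apply: eq_bigr => i _; rewrite mulrACA mulrnAr. Qed.

(** * Weights stable under Leibniz products *)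

Section Weights.
Context {R : realFieldType}.
Implicit Types (a b : nat -> R) (k n w : nat).

Definition tau k : R := k.+1%:R^-1.

Lemma tau_gt0 k : 0 < tau k. Proof. by rewrite invr_gt0 ltr0n. Qed.
Lemma tau_ge0 k : 0 <= tau k. Proof. exact: ltW (tau_gt0 k). Qed.

Lemma tau0 : tau 0 = 1. Proof. exact: invr1. Qed.

Lemma tau_le i n : (i <= n)%N -> tau n <= tau i.
Proof. by move=> h; rewrite lef_pV2 ?posrE ?ltr0n// ler_nat. Qed.

Lemma tau_mul_le i j : tau i * tau j <= tau (i + j).
Proof.
rewrite -invfM lef_pV2 ?posrE ?mulr_gt0 ?ltr0n// -natrM ler_nat.
by rewrite mulSn mulnS; lia.
Qed.

Lemma tau_mul_leD i j : tau i * tau j <= tau (i + j) * (tau i + tau j).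
Proof.
have hi : i.+1%:R != 0 :> R by rewrite pnatr_eq0.
have hj : j.+1%:R != 0 :> R by rewrite pnatr_eq0.
have -> : tau i + tau j = tau i * tau j * (i.+1%:R + j.+1%:R).
  by rewrite /tau; move: i.+1%:R j.+1%:R hi hj => x y hx hy; field; rewrite ?hx ?hy.
rewrite mulrCA ler_peMr ?mulr_ge0 ?tau_ge0// mulrC ler_pdivlMr ?ltr0n// mul1r.
by rewrite -natrD ler_nat; lia.
Qed.

Lemma sum_tau2_le n : \sum_(i < n.+1) tau i ^+ 2 <= 2 - tau n.
Proof.
elim: n => [|n IH]; first by rewrite big_ord_recl big_ord0 tau0; lra.
rewrite big_ord_recr /=.
suff : tau n.+1 ^+ 2 <= tau n - tau n.+1 by lra.
have -> : tau n - tau n.+1 = tau n * tau n.+1.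
  have hn : n.+1%:R != 0 :> R by rewrite pnatr_eq0.
  have hm : n.+2%:R != 0 :> R by rewrite pnatr_eq0.
  move: hm; rewrite /tau -(addn1 n.+1) natrD.
  by move: n.+1%:R hn => x hx hy; field; rewrite ?hx ?hy.
by rewrite expr2 ler_pM2r ?tau_gt0// tau_le.
Qed.

(** The weights 1/(k+1)^2 are stable under convolution: [tau_mul_leD] extracts [tau n], then (x+y)^2
    <= 2x^2 + 2y^2 leaves two copies of a sum that is at most 2. *)
Lemma sum_tau_mul2_le n :
  \sum_(i < n.+1) (tau i * tau (n - i)) ^+ 2 <= 8 * tau n ^+ 2.
Proof.
have le1 (i : 'I_n.+1) : true -> (tau i * tau (n - i)) ^+ 2 <=
    2 * tau n ^+ 2 * (tau i ^+ 2) + 2 * tau n ^+ 2 * (tau (n - i) ^+ 2).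
  move=> _; set x := tau i; set y := tau (n - i).
  have h : x * y <= tau n * (x + y).
    by have := tau_mul_leD i (n - i); rewrite subnKC// -ltnS.
  have x0 : 0 <= x by exact: tau_ge0.
  have y0 : 0 <= y by exact: tau_ge0.
  have /le_trans -> // : (x * y) ^+ 2 <= (tau n * (x + y)) ^+ 2.
    by rewrite ler_pXn2r ?nnegrE ?mulr_ge0 ?addr_ge0 ?tau_ge0.
  have : 0 <= tau n ^+ 2 * (x - y) ^+ 2 by rewrite mulr_ge0 ?sqr_ge0.
  by nra.
have := ler_sum (index_enum _) le1; rewrite big_split /= -!mulr_sumr.
have -> : \sum_(i < n.+1) tau (n - i) ^+ 2 = \sum_(i < n.+1) tau i ^+ 2.
  rewrite [RHS](reindex_inj rev_ord_inj) /=.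
  by apply: eq_bigr => i _; rewrite subSS.
move/le_trans; apply.
have := sum_tau2_le n; have := tau_ge0 n; have := sqr_ge0 (tau n).
move: (\sum_(i < n.+1) _) => S; nra.
Qed.

(* The factor [tau k ^+ 2] makes these weights an algebra for [conv]. *)
Definition wseq (al : nat -> R) (ka : R) k : R :=
  k`!%:R * (tau k ^+ 2 * al k * ka ^+ k).

Lemma conv_wseq_le (al be ga : nat -> R) (ka : R) n : 0 <= ka -> 0 <= ga n ->
  (forall i j, al i * be j <= ga (i + j)%N) ->
  conv (wseq al ka) (wseq be ka) n <= 8 * wseq ga ka n.
Proof.
move=> ka0 ga0 h.
have e (i : 'I_n.+1) : true ->
    wseq al ka i * wseq be ka (n - i) *+ 'C(n, i) <=
    (n`!%:R * ga n * ka ^+ n) * (tau i * tau (n - i)) ^+ 2.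
  move=> _; have lein : (i <= n)%N by rewrite -ltnS.
  rewrite -mulr_natr /wseq -(bin_fact lein) !natrM.
  have -> : ka ^+ n = ka ^+ i * ka ^+ (n - i) by rewrite -exprD subnKC.
  rewrite exprMn.
  have := h i (n - i)%N; rewrite subnKC// => hh.
  set A := i`!%:R; set B := (n - i)`!%:R; set C := 'C(n, i)%:R.
  set x := ka ^+ i; set y := ka ^+ (n - i); set s := tau i ^+ 2; set t := tau _ ^+ 2.
  have -> : A * (s * al i * x) * (B * (t * be (n - i)%N * y)) * C =
     (A * B * C * s * t * x * y) * (al i * be (n - i)%N) by ring.
  have -> : C * (A * B) * ga n * (x * y) * (s * t) =
     (A * B * C * s * t * x * y) * ga n by ring.
  by apply: ler_wpM2l hh; rewrite !mulr_ge0 ?ler0n ?sqr_ge0 ?exprn_ge0 ?tau_ge0.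
apply: le_trans (ler_sum _ e) _; rewrite -mulr_sumr.
have g : 0 <= n`!%:R * ga n * ka ^+ n by rewrite !mulr_ge0 ?exprn_ge0.
have := ler_wpM2l g (sum_tau_mul2_le n).
by rewrite /wseq; nra.
Qed.

End Weights.

Lemma wseq_ge0 (R : realFieldType) (al : nat -> R) (ka : R) n :
  0 <= ka -> (forall k, 0 <= al k) -> 0 <= wseq al ka n.
Proof. by move=> k0 a0; rewrite !mulr_ge0 ?exprn_ge0 ?tau_ge0. Qed.

(** * Differential polynomials and the Lenard recursion *)

Section PolynomialIdentity.
Context {K : numFieldType}.
Implicit Types (p q f : {poly K}).

Lemma poly_fun_eq0 p : (forall x, p.[x] = 0) -> p = 0.
Proof.
move=> p0; apply/eqP/negPn/negP => pn0.
pose rs := [seq i%:R : K | i <- iota 0 (size p)].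
suff : (size rs < size p)%N by rewrite size_map size_iota ltnn.
apply: max_poly_roots => //.
  by apply/allP => x _; rewrite rootE p0.
by rewrite map_inj_uniq ?iota_uniq// => i j /eqP; rewrite eqr_nat => /eqP.
Qed.

Lemma poly_fun_inj p q : (forall x, p.[x] = q.[x]) -> p = q.
Proof.
by move=> h; apply/subr0_eq/poly_fun_eq0 => x; rewrite hornerD hornerN h subrr.
Qed.

Lemma deriv_eq0_const p : p^`() = 0 -> p = (p`_0)%:P.
Proof.
move=> dp; apply/polyP => -[|i]; rewrite coefC//=.
have : p^`()`_i = 0 by rewrite dp coef0.
by rewrite coef_deriv => /eqP; rewrite mulrn_eq0 => /eqP.
Qed.

Definition jet_poly (s : nat -> K) J : {poly K} := \poly_(j < J) (s j / j`!%:R).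

Lemma jet_polyE (s : nat -> K) J j : (j < J)%N -> (jet_poly s J)^`(j).[0] = s j.
Proof.
move=> jJ; rewrite horner_coef0 coef_derivn addn0 ffactnn coef_poly jJ.
by rewrite -[LHS]mulr_natr divfK// pnatr_eq0 -lt0n fact_gt0.
Qed.

Lemma derivn_XsubC_exp (a : K) J j (h : {poly K}) : (j < J)%N ->
  (h * ('X - a%:P) ^+ J)^`(j).[a] = 0.
Proof.
elim: J j h => [//|J IH] [|j] h jJ.
  by rewrite exprS derivn0 !hornerM hornerXsubC subrr mul0r mulr0.
rewrite derivSn derivM deriv_exp /= derivXsubC mul1r exprS mulrA.
by rewrite mulrnAr -mulrnAl -mulrDl; exact: IH.
Qed.

(** With a Bezout identity u X^J + v (X-1)^J = 1 and T the Taylor polynomial of [s], the polynomial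
    T v (X-1)^J = T - T u X^J has both prescribed jets. *)
Lemma hermite_interpolation (s : nat -> K) J : exists f, forall j, (j < J)%N ->
  f^`(j).[0] = s j /\ f^`(j).[1] = 0.
Proof.
have : coprimep (('X - 0%:P) ^+ J) (('X - 1%:P) ^+ J : {poly K}).
  by apply/coprimep_expl/coprimep_expr; rewrite coprimep_XsubC2// sub0r oppr_eq0 oner_eq0.
move/Bezout_eq1_coprimepP => [[u v] /= uv].
pose T := jet_poly s J.
exists (T * v * ('X - 1%:P) ^+ J) => j jJ; split; last exact: derivn_XsubC_exp.
have -> : T * v * ('X - 1%:P) ^+ J = T - (T * u) * ('X - 0%:P) ^+ J.
  by apply/eqP; rewrite eq_sym subr_eq -!mulrA -mulrDr addrC uv mulr1.
by rewrite derivnB hornerD hornerN derivn_XsubC_exp// subr0 jet_polyE.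
Qed.

End PolynomialIdentity.

Section DifferentialPolynomials.
Context {K : numFieldType}.
Implicit Types (p q : dpoly K) (s : nat -> K) (f : {poly K}).

Fixpoint dpoly_at f p : {poly K} :=
  match p with
  | Dconst c => c%:P
  | Dvar j => f^`(j)
  | Dadd p q => dpoly_at f p + dpoly_at f q
  | Dmul p q => dpoly_at f p * dpoly_at f q
  end.

Lemma horner_dpoly_at f p x :
  (dpoly_at f p).[x] = jet_eval (fun j => f^`(j).[x]) p.
Proof.
elim: p => [c|j|p IHp q IHq|p IHp q IHq] /=.
- by rewrite hornerC.
- by [].
- by rewrite hornerD IHp IHq.
- by rewrite hornerM IHp IHq.
Qed.

Lemma deriv_dpoly_at f p : (dpoly_at f p)^`() = dpoly_at f (Dx p).
Proof.
elim: p => [c|j|p IHp q IHq|p IHp q IHq] /=.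
- by rewrite derivC.
- by rewrite -derivnS.
- by rewrite derivD IHp IHq.
- by rewrite derivM IHp IHq.
Qed.

Fixpoint dorder p : nat :=
  match p with
  | Dconst _ => 0
  | Dvar j => j.+1
  | Dadd p q | Dmul p q => maxn (dorder p) (dorder q)
  end.

Lemma eq_jet_eval s s' p : (forall j, (j < dorder p)%N -> s j = s' j) ->
  jet_eval s p = jet_eval s' p.
Proof.
elim: p => [c|j|p IHp q IHq|p IHp q IHq] //= h; first exact: h.
  by rewrite IHp ?IHq// => j jp; apply: h; rewrite leq_max jp ?orbT.
by rewrite IHp ?IHq// => j jp; apply: h; rewrite leq_max jp ?orbT.
Qed.

(** [Dx] acts on syntax, so its compatibility with equality of values needs a proof: any finite jet
    is that of a polynomial f at 0, and the polynomials obtained from [p] and [q] along f coincide,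
    hence so do their derivatives. *)
Lemma jet_eval_Dx_ext p q : (forall s, jet_eval s p = jet_eval s q) ->
  forall s, jet_eval s (Dx p) = jet_eval s (Dx q).
Proof.
move=> pq s; pose J := maxn (dorder (Dx p)) (dorder (Dx q)).
have e r : (dorder r <= J)%N ->
    jet_eval s r = (dpoly_at (jet_poly s J) r).[0].
  move=> rJ; rewrite horner_dpoly_at; apply: eq_jet_eval => j jr.
  by rewrite jet_polyE// (leq_trans jr).
rewrite !e ?leq_maxl ?leq_maxr// -!deriv_dpoly_at; congr (_^`().[_]).
by apply: poly_fun_inj => x; rewrite !horner_dpoly_at.
Qed.

(* A polynomial [f] with jet [s] at 0 and zero jet at 1 joins the two jets, and
   [p] is constant along [f]. *)
Lemma jet_eval_Dx_eq0 p : (forall s, jet_eval s (Dx p) = 0) ->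
  forall s, jet_eval s p = jet_eval (fun=> 0) p.
Proof.
move=> dp s; have [f hf] := hermite_interpolation s (dorder p).
have fc : dpoly_at f p = ((dpoly_at f p)`_0)%:P.
  apply: deriv_eq0_const; rewrite deriv_dpoly_at.
  by apply: poly_fun_eq0 => x; rewrite horner_dpoly_at dp.
transitivity (dpoly_at f p).[0].
  by rewrite horner_dpoly_at; apply: eq_jet_eval => j /hf[].
transitivity (dpoly_at f p).[1]; first by rewrite fc !hornerC.
by rewrite horner_dpoly_at; apply: eq_jet_eval => j /hf[].
Qed.

Lemma jet_eval0_Dx p : jet_eval (fun=> 0) (Dx p) = 0.
Proof.
elim: p => [c|j|p IHp q IHq|p IHp q IHq] //=; rewrite IHp IHq ?addr0//.
by rewrite mul0r mulr0 addr0.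
Qed.

(** Algebraic form of the n-th derivative in x of the differential polynomial [p] along a function
    with jet [s]; estimates on it need no analysis. *)
Definition djet s p n : K := jet_eval s (iter n (@Dx K) p).
Arguments djet : simpl never.

Lemma djetS s p n : djet s p n.+1 = djet s (Dx p) n.
Proof. by rewrite /djet iterSr. Qed.

Lemma djet_ext p q : (forall s, jet_eval s p = jet_eval s q) ->
  forall s n, djet s p n = djet s q n.
Proof.
move=> pq s n; elim: n p q pq s => [|n IH] p q pq s; first exact: pq.
by rewrite !djetS; apply: IH; exact: jet_eval_Dx_ext.
Qed.

Lemma djet_const s c n : djet s (Dconst c) n = c *+ (n == 0)%N.
Proof.
case: n => [|n] //; rewrite djetS mulr0n /=.
by elim: n => [|n IH] //; rewrite djetS.
Qed.

Lemma djet_var s j n : djet s (Dvar j) n = s (j + n)%N.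
Proof.
by elim: n j => [|n IH] j; rewrite ?addn0// djetS IH addSnnS.
Qed.

Lemma djetD s p q n : djet s (Dadd p q) n = djet s p n + djet s q n.
Proof. by elim: n p q => [//|n IH] p q; rewrite !djetS IH. Qed.

Lemma djetM s p q n : djet s (Dmul p q) n = conv (djet s p) (djet s q) n.
Proof.
elim: n p q => [|n IH] p q; first by rewrite conv0.
rewrite djetS djetD !IH convS; congr (_ + _); apply: eq_bigr => i _;
  by rewrite djetS.
Qed.

Lemma djet_sum s (F : nat -> dpoly K) k n :
  djet s (\big[@Dadd K/Dconst 0]_(i < k) F i) n = \sum_(i < k) djet s (F i) n.
Proof.
apply: (big_morph (fun p => djet s p n)) => [p q|]; first exact: djetD.
by rewrite djet_const mul0rn.
Qed.

End DifferentialPolynomials.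

(** * Quadratic recursion for the Lenard operators *)

Section Lenard.
Context {K : numFieldType}.
Variable L : nat -> dpoly K.
Hypothesis hL : is_lenard L.
Implicit Types (p q : dpoly K) (s : nat -> K).

Lemma djetZ s c p n : djet s (Dmul (Dconst c) p) n = c * djet s p n.
Proof. by rewrite djetM; apply: conv_delta => i; rewrite djet_const. Qed.

Lemma lenard0_djet s n : djet s (L 0%N) n = 2^-1 *+ (n == 0)%N.
Proof.
case: hL => h0 _ _; rewrite -(djet_const s).
by apply: djet_ext => s'; rewrite h0.
Qed.

Let quad k i : dpoly K :=
  Dadd (Dmul (Dconst (-1)) (Dmul (L i) (Dx (Dx (L (k - i)%N)))))
    (Dadd (Dmul (Dconst 2^-1) (Dmul (Dx (L i)) (Dx (L (k - i)%N))))
       (Dmul (Dconst (-2)) (Dmul (Dvar 0) (Dmul (L i) (L (k - i)%N))))).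

Let lin k i : dpoly K := Dmul (Dconst 2^-1) (Dmul (L i) (L (k.+1 - i)%N)).

(* Coefficient of [z^(-k)] in [F F'' - F'^2/2 + 2 u F^2 - z F^2/2] with
   [F = sum_k L_k z^(-k)], up to sign: the Lenard recursion is the third order
   linear equation [F''' + (4 u - z) F' + 2 u' F = 0], and this quadratic
   expression is its first integral. *)
Let first_integral k : dpoly K :=
  Dadd (\big[@Dadd K/Dconst 0]_(i < k.+2) lin k i)
       (\big[@Dadd K/Dconst 0]_(i < k.+1) quad k i).

Lemma sum_ord_rev (A : nmodType) (f : nat -> nat -> A) n :
  \sum_(i < n.+1) f i (n - i)%N = \sum_(i < n.+1) f (n - i)%N i.
Proof.
rewrite (reindex_inj rev_ord_inj) /=; apply: eq_bigr => i _.
by rewrite subSS subKn// -ltnS.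
Qed.

Lemma Dx_first_integral s k : jet_eval s (Dx (first_integral k)) = 0.
Proof.
have [_ h1 _] := hL.
change (djet s (first_integral k) 1 = 0).
rewrite djetD !djet_sum.
pose a i n := djet s (L i) n.
have a0 : a 0%N 1%N = 0 by rewrite /a lenard0_djet mulr0n.
have aS i : a i.+1 1%N = a i 3%N + 4 * s 0%N * a i 1%N + 2 * s 1%N * a i 0%N.
  exact: h1.
have half2 : 2^-1 * 2 = 1 :> K by rewrite mulVf// pnatr_eq0.
have hh : 2^-1 + 2^-1 = 1 :> K by rewrite -mulr2n -[LHS]mulr_natr.
have -> : \sum_(i < k.+2) djet s (lin k i) 1 = \sum_(i < k.+2) a i 0%N * a (k.+1 - i)%N 1%N.
  transitivity (\sum_(i < k.+2) (2^-1 * (a i 1%N * a (k.+1 - i)%N 0%N)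
     + 2^-1 * (a i 0%N * a (k.+1 - i)%N 1%N))).
    by apply: eq_bigr => i _; rewrite djetZ djetM convS !conv0 mulrDr.
  rewrite big_split /= (sum_ord_rev _ (fun i j => 2^-1 * (a i 1%N * a j 0%N))).
  rewrite -big_split /=; apply: eq_bigr => i _.
  by rewrite (mulrC (a (_ - _)%N _)) -mulrDl hh mul1r.
rewrite big_ord_recr /= subnn a0 mulr0 addr0.
transitivity (\sum_(i < k.+1) (a i 0%N * a (k - i).+1 1%N + djet s (quad k i) 1)).
  by rewrite [RHS]big_split; apply: f_equal2 => //; apply: eq_bigr => i _; rewrite subSn// -ltnS.
(* Once the Lenard recursion has replaced the derivative of [L (k - i).+1], what is left is a sum
   minus its mirror image under i -> k - i. *)
transitivity (\sum_(i < k.+1) (2^-1 * (a i 2%N * a (k - i)%N 1%N) + 2 * s 0%N * (a i 0%N * a (k - i)%N 1%N))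
  - \sum_(i < k.+1) (2^-1 * (a i 1%N * a (k - i)%N 2%N) + 2 * s 0%N * (a i 1%N * a (k - i)%N 0%N))).
  rewrite -sumrB; apply: eq_bigr => i _.
  rewrite !djetD !djetZ aS !djetM !convS !conv0 !djetM !convS !conv0 !djet_var -!djetS.
  rewrite -!/(a _ _) !add0n.
  by field.
rewrite (sum_ord_rev _ (fun i j => 2^-1 * (a i 1%N * a j 2%N) + 2 * s 0%N * (a i 1%N * a j 0%N))).
by rewrite -sumrB big1// => i _; ring.
Qed.

(** A vanishing total derivative leaves a constant, and the normalisation L_j[0] = 0 for j >= 1
    makes it 0: every [lin] term has a factor of positive index, every [quad] term has a derivative
    or u as a factor. *)
Lemma djet_first_integral s k n : djet s (first_integral k) n = 0.
Proof.
suff h s' : jet_eval s' (first_integral k) = jet_eval s' (Dconst 0).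
  by rewrite (djet_ext _ _ h) djet_const mul0rn.
rewrite (jet_eval_Dx_eq0 _ (fun s => Dx_first_integral s k)).
have [_ _ h2] := hL; set z := fun=> 0 => /=.
have sum0 (F : nat -> dpoly K) m : (forall i, (i < m)%N -> jet_eval z (F i) = 0) ->
    jet_eval z (\big[@Dadd K/Dconst 0]_(i < m) F i) = 0.
  move=> F0; rewrite -[LHS]/(djet z _ 0) djet_sum big1// => i _.
  exact: F0.
rewrite !sum0 ?addr0// => i ik /=.
  by rewrite !jet_eval0_Dx !(mul0r, mulr0, addr0).
case: i ik => [|i] _; first by rewrite (h2 k.+1)// !mulr0.
by rewrite (h2 i.+1)// mul0r mulr0.
Qed.

(** The first integral solved for its top term: as L_0 = 1/2, the two extreme [lin] terms are linear
    in L_(k+1), and everything else involves only L_0, ..., L_k. *)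
Lemma lenard_quadratic s k n :
  djet s (L k.+1) n =
    2 * \sum_(i < k.+1)
      (conv (djet s (L i)) (fun m => djet s (L (k - i)) m.+2) n
       - 2^-1 * conv (fun m => djet s (L i) m.+1)
                     (fun m => djet s (L (k - i)) m.+1) n
       + 2 * conv s (conv (djet s (L i)) (djet s (L (k - i)))) n)
    - \sum_(i < k) conv (djet s (L i.+1)) (djet s (L (k - i))) n.
Proof.
have := djet_first_integral s k n; rewrite djetD !djet_sum.
set d := djet s (L k.+1) n; set S := \sum_(i < k) _.
have -> : \sum_(i < k.+2) djet s (lin k i) n =
    2^-1 * (2^-1 * d) + (2^-1 * S + 2^-1 * (2^-1 * d)).
  rewrite big_ord_recl; under eq_bigr => i _ do rewrite lift0.
  rewrite big_ord_recr !djetZ mulr_sumr !djetM subn0 subnn.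
  rewrite [conv _ (djet s (L 0%N)) n]convC.
  rewrite !(conv_delta _ 2^-1); try by move=> i; rewrite lenard0_djet.
  congr (_ + (_ + _)); apply: eq_bigr => i _.
  by rewrite djetZ djetM subSS.
under eq_bigr => i _.
  rewrite !djetD !djetZ !djetM.
  rewrite (@eq_conv _ (djet s (Dvar 0)) s _ (conv (djet s (L i)) (djet s (L (k - i)%N)))); first last.
  - by move=> m; rewrite djetM.
  - by move=> m; rewrite djet_var.
  over.
set T := \sum_(i < k.+1) _ => h.
set T' := \sum_(i < k.+1) _.
have -> : T' = - T.
  rewrite /T /T' -sumrN; apply: eq_bigr => i _.
  set b := L (k - i)%N.
  have -> : conv (djet s (L i)) (fun m => djet s b m.+2) n =
      conv (djet s (L i)) (djet s (Dx (Dx b))) n.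
    by apply: eq_conv => // m; rewrite !djetS.
  have -> : conv (fun m => djet s (L i) m.+1) (fun m => djet s b m.+1) n =
      conv (djet s (Dx (L i))) (djet s (Dx b)) n.
    by apply: eq_conv => m; rewrite djetS.
  by ring.
have -> : T = - (2^-1 * (2^-1 * d) + (2^-1 * S + 2^-1 * (2^-1 * d))).
  by move/eqP: h; rewrite addrC addr_eq0 => /eqP.
by field.
Qed.

End Lenard.
Arguments lenard0_djet {K L} hL.
Arguments lenard_quadratic {K L} hL.

(** * Size of the Lenard differential polynomials *)

Section Modulus.
Context {R : realType}.
Implicit Types (x y : Cplx R) (a b : nat -> Cplx R).

(** The norm on [Cplx R] takes values in [Cplx R]; a real-valued copy lets the estimates run in the
    ordered field [R]. *)
Definition cnorm x : R := complex.Re `|x|.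

Lemma toC_cnorm x : toC (cnorm x) = `|x|.
Proof. by rewrite /toC /cnorm RRe_real// normr_real. Qed.

Lemma toC_le (r s : R) : (toC r <= toC s) = (r <= s).
Proof. exact: lecR. Qed.

Lemma toC_lt (r s : R) : (toC r < toC s) = (r < s).
Proof. exact: ltcR. Qed.

Lemma toC_inj : injective (@toC R).
Proof. exact: complexI. Qed.

Lemma toCD (r s : R) : toC (r + s) = toC r + toC s.
Proof. exact: (rmorphD (real_complex R)). Qed.

Lemma toCM (r s : R) : toC (r * s) = toC r * toC s.
Proof. exact: (rmorphM (real_complex R)). Qed.

Lemma toC_nat n : toC n%:R = n%:R :> Cplx R.
Proof. exact: (rmorph_nat (real_complex R)). Qed.

Lemma toC0 : toC 0 = 0 :> Cplx R.
Proof. exact: toC_nat 0%N. Qed.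

Lemma toC1 : toC 1 = 1 :> Cplx R.
Proof. exact: toC_nat 1%N. Qed.

Lemma cnorm_ge0 x : 0 <= cnorm x.
Proof. by rewrite -toC_le toC_cnorm toC0 normr_ge0. Qed.

Lemma cnormM x y : cnorm (x * y) = cnorm x * cnorm y.
Proof. by apply: toC_inj; rewrite toCM !toC_cnorm normrM. Qed.

Lemma cnormD x y : cnorm (x + y) <= cnorm x + cnorm y.
Proof. by rewrite -toC_le toCD !toC_cnorm ler_normD. Qed.

Lemma cnormN x : cnorm (- x) = cnorm x.
Proof. by rewrite /cnorm normrN. Qed.

Lemma cnormB x y : cnorm (x - y) <= cnorm x + cnorm y.
Proof. by rewrite -(cnormN y) cnormD. Qed.

Lemma cnorm_nat n : cnorm n%:R = n%:R.
Proof. by apply: toC_inj; rewrite toC_cnorm toC_nat normr_nat. Qed.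

Lemma cnorm0 : cnorm 0 = 0.
Proof. exact: cnorm_nat 0. Qed.

Lemma cnorm1 : cnorm 1 = 1.
Proof. exact: cnorm_nat 1. Qed.

Lemma cnorm_toC (r : R) : 0 <= r -> cnorm (toC r) = r.
Proof.
move=> r0; apply: toC_inj; rewrite toC_cnorm ger0_norm//.
by rewrite -toC0 toC_le.
Qed.

Lemma cnorm_eq0 x : (cnorm x == 0) = (x == 0).
Proof.
by rewrite -[RHS]normr_eq0 -toC_cnorm -toC0 (inj_eq toC_inj).
Qed.

Lemma cnormX x n : cnorm (x ^+ n) = cnorm x ^+ n.
Proof. by elim: n => [|n IH]; rewrite ?cnorm1// !exprS cnormM IH. Qed.

Lemma cnormV x : cnorm x^-1 = (cnorm x)^-1.
Proof.
have [->|x0] := eqVneq x 0; first by rewrite invr0 cnorm0 invr0.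
have cx0 : cnorm x != 0 by rewrite cnorm_eq0.
by apply: (mulfI cx0); rewrite -cnormM !divff// cnorm1.
Qed.

Lemma cnorm_sum_le n (F : 'I_n -> Cplx R) (B : R) :
  (forall i, cnorm (F i) <= B) -> cnorm (\sum_(i < n) F i) <= n%:R * B.
Proof.
elim: n F => [|n IH] F h; first by rewrite big_ord0 cnorm0 mul0r.
rewrite big_ord_recr /= -natr1 mulrDl mul1r.
by apply: le_trans (cnormD _ _) _; apply: lerD => //; apply: IH.
Qed.

Lemma cnorm_conv_le a b (A B : nat -> R) n :
  (forall i, cnorm (a i) <= A i) -> (forall i, cnorm (b i) <= B i) ->
  cnorm (conv a b n) <= conv A B n.
Proof.
move=> hA hB; rewrite /conv.
elim/big_rec2: _ => [|i y x _ IH]; first by rewrite cnorm0.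
apply: le_trans (cnormD _ _) _; apply: lerD => //.
rewrite -[_ *+ _]mulr_natr -[leRHS]mulr_natr !cnormM cnorm_nat ler_wpM2r//.
by rewrite ler_pM ?cnorm_ge0.
Qed.

End Modulus.

(** * Weighted bounds on jets *)

Section WeightedJets.
Context {R : realType}.
Variables (N : nat) (la ka mu : R).
Hypotheses (la0 : 0 <= la) (ka0 : 0 <= ka) (mu01 : 0 <= mu <= 1).

Let mu0 : 0 <= mu. Proof. by case/andP: mu01. Qed.

(* The size of the [k]-th derivative of a differential polynomial of weight
   [w], where [u] has weight 2 and [d/dx] weight 1. *)
Definition jetw w k : R :=
  la ^+ w * wseq (fun k => tau k ^+ N.*2 * (1 + k%:R * mu) ^+ w) ka k.

Lemma jetw_ge0 w k : 0 <= jetw w k.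
Proof.
rewrite mulr_ge0 ?exprn_ge0// wseq_ge0// => i.
by rewrite mulr_ge0 ?exprn_ge0 ?tau_ge0 ?addr_ge0 ?mulr_ge0.
Qed.

Lemma conv_jetw_le w v n : conv (jetw w) (jetw v) n <= 8 * jetw (w + v) n.
Proof.
rewrite /jetw convZ -exprD mulrCA ler_wpM2l ?exprn_ge0//.
have b_ge0 (i : nat) : 0 <= 1 + i%:R * mu by rewrite addr_ge0 ?mulr_ge0.
apply: conv_wseq_le => // [|i j].
  by rewrite mulr_ge0 ?exprn_ge0 ?tau_ge0.
rewrite mulrACA -exprMn.
apply: ler_pM; rewrite ?mulr_ge0 ?exprn_ge0 ?mulr_ge0 ?tau_ge0//.
  by rewrite lerXn2r ?nnegrE ?mulr_ge0 ?tau_ge0 ?tau_mul_le.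
rewrite exprD; apply: ler_pM; rewrite ?exprn_ge0//.
  by rewrite lerXn2r ?nnegrE// lerD2l ler_wpM2r// ler_nat leq_addr.
by rewrite lerXn2r ?nnegrE// lerD2l ler_wpM2r// ler_nat leq_addl.
Qed.

(** A derivative costs (k+1) ka, and since mu <= 1 this is at most E la (1 + k mu), one unit of
    weight. The factor 2^w pays for replacing 1 + (k+1) mu by 2 (1 + k mu). *)
Lemma jetwS_le (E : R) w k : 0 <= E -> ka <= E * la * mu ->
  jetw w k.+1 <= 2 ^+ w * E * jetw w.+1 k.
Proof.
move=> E0 kaE; rewrite /jetw /wseq factS natrM.
set b := 1 + k%:R * mu.
have b0 : 0 <= b by rewrite addr_ge0 ?mulr_ge0.
have bS : (1 + k.+1%:R * mu) ^+ w <= 2 ^+ w * b ^+ w.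
  rewrite -exprMn lerXn2r ?nnegrE ?addr_ge0 ?mulr_ge0//.
  rewrite -natr1 mulrDl mul1r /b.
  have : 0 <= k%:R * mu by rewrite mulr_ge0.
  by case/andP: mu01; lra.
have tS n : tau k.+1 ^+ n <= tau k ^+ n :> R.
  by rewrite lerXn2r ?nnegrE ?tau_ge0 ?tau_le.
have kk : k.+1%:R * ka <= E * la * b.
  apply: le_trans (ler_wpM2l _ kaE) _ => //.
  rewrite mulrCA ler_wpM2l ?mulr_ge0// /b -natr1 mulrDl mul1r addrC.
  by rewrite lerD2r; case/andP: mu01.
rewrite (exprS la) (exprS b) (exprS ka).
set x := la ^+ w; set f := k`!%:R; set z := ka ^+ k; set t := tau k ^+ 2.
have -> : x * (k.+1%:R * f * (tau k.+1 ^+ 2 * (tau k.+1 ^+ N.*2 * (1 + k.+1%:R * mu) ^+ w) * (ka * z))) =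
  (x * f * z) * ((tau k.+1 ^+ 2 * tau k.+1 ^+ N.*2) * ((1 + k.+1%:R * mu) ^+ w * (k.+1%:R * ka))) by ring.
have -> : 2 ^+ w * E * (la * x * (f * (t * (tau k ^+ N.*2 * (b * b ^+ w)) * z))) =
  (x * f * z) * ((t * tau k ^+ N.*2) * ((2 ^+ w * b ^+ w) * (E * la * b))) by ring.
rewrite ler_wpM2l ?mulr_ge0 ?exprn_ge0//.
have b1 : 0 <= 1 + k.+1%:R * mu by rewrite addr_ge0 ?mulr_ge0.
apply: ler_pM; rewrite ?mulr_ge0 ?exprn_ge0 ?tau_ge0//.
  by apply: ler_pM; rewrite ?exprn_ge0 ?tau_ge0.
by apply: ler_pM; rewrite ?exprn_ge0 ?mulr_ge0.
Qed.

Lemma cnorm_conv_jetw (a b : nat -> Cplx R) (A B : R) w v u :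
  (forall n, cnorm (a n) <= A * jetw w n) ->
  (forall n, cnorm (b n) <= B * jetw v n) -> 0 <= A -> 0 <= B ->
  u = (w + v)%N ->
  forall n, cnorm (conv a b n) <= 8 * A * B * jetw u n.
Proof.
move=> ha hb A0 B0 -> n; apply: le_trans (cnorm_conv_le _ _ _ _ _ ha hb) _.
rewrite convZ (_ : 8 * A * B * _ = A * B * (8 * jetw (w + v) n)); last by ring.
rewrite ler_wpM2l ?mulr_ge0//.
exact: conv_jetw_le.
Qed.

Lemma cnorm_jetwS (a : nat -> Cplx R) (A E : R) W w :
  0 <= A -> 0 <= E -> ka <= E * la * mu -> (w <= W)%N ->
  (forall n, cnorm (a n) <= A * jetw w n) ->
  forall n, cnorm (a n.+1) <= A * (2 ^+ W * E) * jetw w.+1 n.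
Proof.
move=> A0 E0 h wW ha n; apply: le_trans (ha _) _.
rewrite -mulrA ler_wpM2l//; apply: le_trans (jetwS_le _ _ _ E0 h) _.
by rewrite ler_wpM2r ?jetw_ge0// ler_wpM2r// ler_weXn2l// ler1n.
Qed.

End WeightedJets.

(** The point is uniformity: [C] is chosen before [la], [ka], [mu] and the jet, so a single constant
    serves all points and all indices. *)
Lemma lenard_jetw_bound (R : realType) (L : nat -> dpoly (Cplx R)) (N : nat) (E : R) k :
  is_lenard L -> 0 <= E ->
  exists2 C : R, 0 <= C & forall (la ka mu : R) (s : nat -> Cplx R),
    0 <= la -> 0 <= ka -> 0 <= mu <= 1 -> ka <= E * la * mu ->
    (forall n, cnorm (s n) <= E * jetw N la ka mu 2 n) ->
    forall j, (j <= k)%N -> forall n,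
      cnorm (djet s (L j) n) <= C * jetw N la ka mu j.*2 n.
Proof.
move=> hL E0; elim: k => [|k [C C0 IH]].
  exists 1 => // la ka mu s la0 ka0 mu01 _ _ j; rewrite leqn0 => /eqP-> n.
  rewrite (lenard0_djet hL) mul1r; case: n => [|n]; last first.
    by rewrite mulr0n cnorm0 jetw_ge0.
  rewrite mulr1n cnormV cnorm_nat /jetw /wseq /= tau0 fact0 mul0r addr0.
  by rewrite !expr0 !expr1n !mulr1 invf_le1// ler1n.
(* [D] is the price of one derivative at weights up to 2k+1. [T1], [T2], [T3] bound the terms L_i
   L_j'', L_i' L_j' and u L_i L_j of the quadratic recursion, with a factor 8 for each product. *)
pose D := 2 ^+ k.*2.+1 * E : R.
pose T1 := 8 * C * (C * D * D); pose T2 := 8 * (C * D) * (C * D).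
pose T3 := 8 * E * (8 * C * C).
pose C' := 2 * (k.+1%:R * (T1 + 2^-1 * T2 + 2 * T3)) + k%:R * (8 * C * C).
have D0 : 0 <= D by rewrite mulr_ge0 ?exprn_ge0.
have T10 : 0 <= T1 by rewrite !mulr_ge0.
have T20 : 0 <= T2 by rewrite !mulr_ge0.
have T30 : 0 <= T3 by rewrite !mulr_ge0.
have C'0 : 0 <= C' by rewrite !addr_ge0 ?mulr_ge0 ?addr_ge0 ?mulr_ge0 ?invr_ge0.
exists (C + C') => [|la ka mu s la0 ka0 mu01 kaE hs j]; first exact: addr_ge0.
have W0 := jetw_ge0 N la ka mu la0 ka0 mu01.
have {}IH := IH la ka mu s la0 ka0 mu01 kaE hs.
rewrite leq_eqVlt => /orP[/eqP-> n|jk n]; last first.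
  by apply: le_trans (IH _ _ n) _ => //; rewrite ler_wpM2r// lerDl.
rewrite (lenard_quadratic hL).
set W := jetw N la ka mu k.+1.*2 n.
have Wn0 : 0 <= W by exact: W0.
suff : cnorm (2 * \sum_(i < k.+1) (conv (djet s (L i)) (fun m => djet s (L (k - i)%N) m.+2) n
       - 2^-1 * conv (fun m => djet s (L i) m.+1)
                     (fun m => djet s (L (k - i)%N) m.+1) n
       + 2 * conv s (conv (djet s (L i)) (djet s (L (k - i)%N))) n)
    - \sum_(i < k) conv (djet s (L i.+1)) (djet s (L (k - i)%N)) n) <= C' * W.
  by move/le_trans; apply; rewrite ler_wpM2r// lerDr.
have cc := cnorm_conv_jetw N la ka mu la0 ka0 mu01.
have cS := cnorm_jetwS N la ka mu la0 ka0 mu01.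
apply: le_trans (cnormB _ _) _; rewrite [leRHS]mulrDl; apply: lerD; last first.
  rewrite -(mulrA k%:R); apply: cnorm_sum_le => i.
  have ik : (i.+1 <= k)%N by [].
  have ki : (k - i <= k)%N by exact: leq_subr.
  refine (cc _ _ C C _ _ _ (IH _ ik) (IH _ ki) C0 C0 _ n).
  by rewrite -doubleD addSn subnKC// ltnW.
rewrite cnormM cnorm_nat -mulrA ler_wpM2l// -mulrA.
apply: cnorm_sum_le => i.
have ik : (i <= k)%N by rewrite -ltnS.
have ki : (k - i <= k)%N by exact: leq_subr.
have kE : (i.*2 + (k - i).*2)%N = k.*2 by rewrite -doubleD subnKC.
have a1 p (pk : (p <= k)%N) m : cnorm (djet s (L p) m.+1) <= C * D * jetw N la ka mu p.*2.+1 m.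
  by refine (cS _ C E _ _ C0 E0 kaE _ (IH _ pk) m); rewrite leqW// leq_double.
have CD0 : 0 <= C * D by rewrite mulr_ge0.
have a2 p (pk : (p <= k)%N) m : cnorm (djet s (L p) m.+2) <= C * D * D * jetw N la ka mu p.*2.+2 m.
  by refine (cS (fun m => djet s (L p) m.+1) (C * D) E _ _ CD0 E0 kaE _ (a1 _ pk) m); rewrite ltnS leq_double.
have CDD0 : 0 <= C * D * D by rewrite mulr_ge0.
rewrite [leRHS]mulrDl [X in _ <= X + _]mulrDl.
apply: le_trans (cnormD _ _) _; apply: lerD.
  apply: le_trans (cnormB _ _) _; apply: lerD.
    by refine (cc _ _ C (C * D * D) _ _ _ (IH _ ik) (a2 _ ki) C0 CDD0 _ n); rewrite !addnS kE.
  rewrite cnormM cnormV cnorm_nat -mulrA ler_wpM2l ?invr_ge0//.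
  by refine (cc _ _ (C * D) (C * D) _ _ _ (a1 _ ik) (a1 _ ki) CD0 CD0 _ n); rewrite addSn addnS kE.
rewrite cnormM cnorm_nat -mulrA ler_wpM2l//.
have CC0 : 0 <= 8 * C * C by rewrite !mulr_ge0.
have b m : cnorm (conv (djet s (L i)) (djet s (L (k - i)%N)) m) <= 8 * C * C * jetw N la ka mu k.*2 m.
  by refine (cc _ _ C C _ _ _ (IH _ ik) (IH _ ki) C0 C0 _ m); rewrite kE.
by refine (cc _ _ E (8 * C * C) _ _ _ hs b E0 CC0 _ n).
Qed.

(** * Derivatives of rational functions *)

Section Jets.
Context {K : numFieldType}.
Implicit Types (Om : set K) (F G : nat -> K -> K) (p q : {poly K}).

Lemma is_derive_horner p (x : K) : is_derive x 1 (horner p) p^`().[x].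
Proof.
elim/poly_ind: p => [|p c IH].
  rewrite deriv0 horner0 (_ : horner 0 = cst 0); first exact: is_derive_cst.
  by apply/funext => y; rewrite horner0.
rewrite (_ : horner _ = horner p * id + cst c); last first.
  by apply/funext => y; rewrite hornerMXaddC.
apply: is_derive_eq.
by rewrite derivMXaddC hornerD hornerM hornerX addr0 /GRing.scale /= mulr1 mulrC addrC.
Qed.

Lemma open_neq0 : open [set x : K | x != 0].
Proof.
rewrite (_ : [set x | _] = ~` [set 0]).
  exact/closed_openC/accessible_closed_set1/hausdorff_accessible/norm_hausdorff.
by apply/seteqP; split => x /= /eqP.
Qed.

Lemma open_horner_neq0 p : open [set x | p.[x] != 0].
Proof.
apply: (@open_comp _ _ (horner p) [set y | y != 0]); last exact: open_neq0.
move=> x _; apply: differentiable_continuous.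
by apply/derivable1_diffP; have [dp _] := is_derive_horner p x.
Qed.

(* [F n] is the [n]-th derivative of [F 0] on [Om]. *)
Definition is_jet Om F : Prop :=
  forall n x, Om x -> is_derive x 1 (F n) (F n.+1 x).

Lemma is_jet_uniq Om F G : open Om -> is_jet Om F -> is_jet Om G ->
  (forall x, Om x -> F 0%N x = G 0%N x) ->
  forall n x, Om x -> F n x = G n x.
Proof.
move=> oOm jF jG FG0; elim=> [//|n IH] x Omx.
have [_ <-] := jF n x Omx; have [_ <-] := jG n x Omx.
apply: near_eq_derive; near=> y; apply: IH.
near: y; exact: open_nbhs_nbhs.
Unshelve. all: by end_near. Qed.

Lemma is_jet_eq Om F G : open Om -> is_jet Om F ->
  (forall n x, Om x -> F n x = G n x) -> is_jet Om G.
Proof.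
move=> oOm jF FG n x Omx; rewrite -FG//.
apply: near_eq_is_derive (jF n x Omx); near=> y; apply: FG.
near: y; exact: open_nbhs_nbhs.
Unshelve. all: by end_near. Qed.

Lemma is_jetD Om F G : is_jet Om F -> is_jet Om G ->
  is_jet Om (fun n x => F n x + G n x).
Proof.
by move=> jF jG n x Omx; apply: is_deriveD; [exact: jF|exact: jG].
Qed.

Lemma is_jetZ Om c F : is_jet Om F -> is_jet Om (fun n x => c * F n x).
Proof.
by move=> jF n x Omx; have := jF n x Omx; exact: is_deriveZ.
Qed.

Lemma is_jetS Om F : is_jet Om F -> is_jet Om (fun n => F n.+1).
Proof. by move=> jF n x Omx; exact: jF. Qed.

Lemma is_jet_conv Om F G : is_jet Om F -> is_jet Om G ->
  is_jet Om (fun n x => conv (F^~ x) (G^~ x) n).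
Proof.
move=> jF jG n x Omx; rewrite /= convS /conv -big_split /=.
rewrite (_ : (fun x => _) = \sum_(i < n.+1) ('C(n, i)%:R *: (F i * G (n - i)%N))); last first.
  apply/funext => y; rewrite fct_sumE; apply: eq_bigr => i _.
  by rewrite -[LHS]mulr_natl.
apply: is_derive_eq; first apply: is_derive_sum => i.
  by apply: is_deriveZ; apply: is_deriveM; [exact: jF|exact: jG].
apply: eq_bigr => i _ /=; rewrite -mulrnDl -[RHS]mulr_natl /GRing.scale /=.
by rewrite addrC [F i.+1 x * _]mulrC.
Qed.

Lemma is_jet_derive1n Om F f : open Om -> is_jet Om F ->
  (forall x, Om x -> f x = F 0%N x) ->
  forall n x, Om x -> derive1n n f x = F n x.
Proof.
move=> oOm jF f0; elim=> [//|n IH] x Omx.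
rewrite derive1nS derive1E; have [_ <-] := jF n x Omx.
apply: near_eq_derive; near=> y; apply: IH.
near: y; exact: open_nbhs_nbhs.
Unshelve. all: by end_near. Qed.

Lemma is_jet_dpoly Om F (P : dpoly K) : is_jet Om F ->
  is_jet Om (fun n x => djet (F^~ x) P n).
Proof.
move=> jF n x Omx; rewrite /djet iterS; move: (iter n _ _) => {n P}.
elim=> [c|j|p IHp q IHq|p IHp q IHq] /=.
- exact: is_derive_cst.
- exact: jF.
- exact: is_deriveD.
- have [d1 d2] := is_deriveM IHp IHq; split; first exact: d1.
  rewrite d2.
  by rewrite /GRing.scale /= addrC [_ * jet_eval _ (Dx p)]mulrC.
Qed.

(** Numerator of the n-th derivative of q'/q over q^(n+1). The closed form supplies the
    differentiability to all orders that [derive1n], a total operation, does not guarantee. *)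
Fixpoint log_deriv_num q n : {poly K} :=
  if n is n'.+1 then
    (log_deriv_num q n')^`() * q - n'.+1%:R *: (log_deriv_num q n' * q^`())
  else q^`().

Lemma is_jet_log_deriv q :
  is_jet [set x | q.[x] != 0] (fun n => derive1n n (log_deriv q)).
Proof.
set Om := [set _ | _]; have oOm : open Om by exact: open_horner_neq0.
pose F n x := (log_deriv_num q n).[x] * q.[x] ^- n.+1.
have jF : is_jet Om F.
  move=> n x /= qx.
  have dV : is_derive x 1 (fun y => (q.[y])^-1) (- q.[x] ^- 2 *: q^`().[x]).
    have [dq <-] := is_derive_horner q x.
    by split; [exact: derivableV|rewrite deriveV].
  rewrite (_ : F n = horner (log_deriv_num q n) * (fun y => (q.[y])^-1) ^+ n.+1); last first.
    by apply/funext => y; rewrite /F -exprVn fctE exprfctE.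
  have dp := is_derive_horner (log_deriv_num q n) x.
  apply: is_derive_eq.
  rewrite /F /= exprfctE /GRing.scale /= hornerD hornerN hornerZ !hornerM.
  rewrite -!exprVn.
  have qq : q.[x] * q.[x]^-1 = 1 by rewrite divff.
  move: (q.[x]^-1) qq => w qq; rewrite !exprS.
  by ring: qq.
have F0 y : Om y -> log_deriv q y = F 0%N y by rewrite /F expr1.
apply: (is_jet_eq _ _ _ oOm jF) => n x Omx.
exact/esym/(is_jet_derive1n _ _ _ oOm jF F0).
Qed.

Lemma derive1n_VY_potential q n x : q.[x] != 0 ->
  derive1n n (VY_potential q) x = 2 * derive1n n.+1 (log_deriv q) x.
Proof.
move=> qx; have oOm := open_horner_neq0 q.
have jv := is_jetZ _ 2 _ (is_jetS _ _ (is_jet_log_deriv q)).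
exact: (is_jet_derive1n _ _ _ oOm jv).
Qed.

Lemma derive1n_log_derivX n (x : K) : x != 0 ->
  derive1n n (log_deriv 'X) x = (-1) ^+ n * n`!%:R / x ^+ n.+1.
Proof.
move=> x0; pose F n (y : K) := (-1) ^+ n * n`!%:R * y ^- n.+1.
have oOm : open [set y : K | y != 0] by exact: open_neq0.
have jF : is_jet [set y : K | y != 0] F.
  move=> k y /= y0.
  have dV : is_derive y 1 (fun z : K => z^-1) (- y ^- 2 *: 1).
    split; first exact: derivableV.
    by rewrite deriveV// derive_id.
  rewrite (_ : F k = ((-1) ^+ k * k`!%:R) *: (fun z : K => z^-1) ^+ k.+1); last first.
    by apply/funext => z; rewrite /F -exprVn !fctE.
  apply: is_derive_eq.
  rewrite /F /GRing.scale /=. rewrite -!exprVn factS natrM !exprS.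
  by ring.
have F0 y : [set y : K | y != 0] y -> log_deriv 'X y = F 0%N y.
  by rewrite /F /log_deriv derivX hornerX hornerC expr0 fact0 !mul1r expr1.
exact: (is_jet_derive1n _ _ _ oOm jF F0).
Qed.

End Jets.

Lemma is_jet_sub (K : numFieldType) (Om Om' : set K) (F : nat -> K -> K) :
  Om' `<=` Om -> is_jet Om F -> is_jet Om' F.
Proof. by move=> s jF n x /s; exact: jF. Qed.

(** * The evolution equation for the potentials *)

Section Recursion.
Context {K : numFieldType}.
Variables (N : nat) (L : nat -> dpoly K) (Q : nat -> {poly K}).
Hypothesis hQ : is_higher_VY N L Q.

Definition vy_jet k n x : K := derive1n n (VY_potential (Q k)) x.

Definition lenard_jet k n x : K := djet ((vy_jet k)^~ x) (L N) n.

Definition inv_jet n (x : K) : K := derive1n n (log_deriv 'X) x.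

(* The jet of [2 L_N[u_k] / x]. *)
Definition vy_ell k n x : K :=
  2 * conv (inv_jet^~ x) ((lenard_jet k)^~ x) n.

(* With [R = Q_(m+2) Q_m / Q_(m+1)^2], the jet of [R' / R - 1 / x]. *)
Definition vy_zeta m n x : K :=
  derive1n n (log_deriv (Q m.+2)) x + derive1n n (log_deriv (Q m)) x
  + (-2) * derive1n n (log_deriv (Q m.+1)) x + (-1) * inv_jet n x.

Lemma inv_jetE n x : x != 0 -> inv_jet n x = (-1) ^+ n * n`!%:R / x ^+ n.+1.
Proof. exact: derive1n_log_derivX. Qed.

Lemma vy_jet_diff2 m n x : (Q m).[x] != 0 -> (Q m.+1).[x] != 0 ->
  (Q m.+2).[x] != 0 ->
  vy_jet m.+2 n x - 2 * vy_jet m.+1 n x + vy_jet m n x =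
    2 * (inv_jet n.+1 x + vy_zeta m n.+1 x).
Proof.
move=> q0 q1 q2; rewrite /vy_jet !derive1n_VY_potential// /vy_zeta.
by ring.
Qed.

Let Om m := [set x | (Q m * Q m.+1 * Q m.+2 * 'X).[x] != 0].

Let OmE m x : Om m x ->
  [/\ (Q m).[x] != 0, (Q m.+1).[x] != 0, (Q m.+2).[x] != 0 & x != 0].
Proof.
rewrite /Om /= !hornerM hornerX !mulf_eq0 !negb_or.
by move=> /andP[/andP[/andP[-> ->] ->] ->].
Qed.

Let jet_v k m : (forall x, Om m x -> (Q k).[x] != 0) ->
  is_jet (Om m) (fun n => derive1n n (log_deriv (Q k))).
Proof. by move=> h; apply: is_jet_sub (is_jet_log_deriv (Q k)). Qed.

Let jet_inv m : is_jet (Om m) inv_jet.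
Proof.
apply: is_jet_sub (is_jet_log_deriv 'X) => x /OmE[_ _ _ x0] /=.
by rewrite hornerX.
Qed.

Let jet_lenard m : is_jet (Om m) (lenard_jet m.+1).
Proof.
have oOm : open (Om m) by exact: open_horner_neq0.
have jv : is_jet (Om m) (fun n => derive1n n (log_deriv (Q m.+1))).
  by apply: jet_v => x /OmE[].
apply: is_jet_dpoly; apply: (is_jet_eq _ _ _ oOm (is_jetZ _ 2 _ (is_jetS _ _ jv))).
by move=> n x /OmE[_ q1 _ _]; rewrite /vy_jet derive1n_VY_potential.
Qed.

(** With R = x (1 - ell), the function R'/R - 1/x equals -ell'/(1 - ell). It is stated multiplied
    out, so that no quotient by 1 - ell has to be differentiated or estimated. *)
Let vy_zeta0 m x : Om m x ->
  vy_zeta m 0 x = - vy_ell m.+1 1 x + vy_ell m.+1 0 x * vy_zeta m 0 x.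
Proof.
move=> Omx; have [q0 q1 q2 x0] := OmE _ _ Omx.
have oOm : open (Om m) by exact: open_horner_neq0.
have [_ _ hrec] := hQ.
set a := Q m.+2; set b := Q m.+1; set c := Q m.
have e y : Om m y -> (a * c).[y] = b.[y] ^+ 2 * (y - 2 * lenard_jet m.+1 0 y).
  by move=> /OmE[_ b0 _ _]; rewrite hornerM; exact: (hrec m.+1).
have d1 : 'D_1 (horner (a * c)) x = (a * c)^`().[x].
  by have [_ <-] := is_derive_horner (a * c) x.
have jl := jet_lenard m 0%N x Omx.
have jb := is_derive_horner (b ^+ 2) x.
have d2 : 'D_1 (fun y => b.[y] ^+ 2 * (y - 2 * lenard_jet m.+1 0 y)) x =
    (b ^+ 2)^`().[x] * (x - 2 * lenard_jet m.+1 0 x) + b.[x] ^+ 2 * (1 - 2 * lenard_jet m.+1 1 x).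
  have dl := is_deriveB (is_derive_id x 1) (is_deriveZ 2 jl).
  have [_ h] := is_deriveM jb dl.
  rewrite (_ : (fun y => _) = horner (b ^+ 2) * (id - 2 \*: lenard_jet m.+1 0)); last first.
    by apply/funext => y; rewrite !fctE horner_exp.
  by rewrite h horner_exp /GRing.scale /=; rewrite addrC mulrC.
have : (a * c)^`().[x] = (b ^+ 2)^`().[x] * (x - 2 * lenard_jet m.+1 0 x) + b.[x] ^+ 2 * (1 - 2 * lenard_jet m.+1 1 x).
  rewrite -d1 -d2; apply: near_eq_derive; near=> y; apply: e.
  near: y; exact: open_nbhs_nbhs.
have := e x Omx.
rewrite /vy_zeta /vy_ell conv0 convS !conv0 !inv_jetE// /log_deriv -/a -/b -/c.
rewrite derivM deriv_exp !(hornerM, hornerD, hornerMn) /= expr1.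

rewrite !(expr0, expr1, fact0, mul1r, mulr1n).
move: (lenard_jet m.+1 0 x) (lenard_jet m.+1 1 x) => L0 L1.
move: q0 q1 q2 x0; rewrite -/a -/b -/c.
move: a.[x] b.[x] c.[x] (a^`().[x]) (b^`().[x]) (c^`().[x]) => A B C A' B' C' C0 B0 A0 x0 e0 e1.
have two0 : 2 != 0 :> K by rewrite pnatr_eq0.
(* The recursion and its derivative are solved for the values of L_N and L_N'; after substitution
   the claim is an identity of rational functions. *)
have hR : x - 2 * L0 = A * C / B ^+ 2 by rewrite e0 [B ^+ 2 * _]mulrC mulfK// expf_neq0.
have hL0 : L0 = (x - A * C / B ^+ 2) / 2 by rewrite -hR; field.
have hL1 : L1 = (1 - (A' * C + A * C' - 2 * B * B' * (A * C / B ^+ 2)) / B ^+ 2) / 2.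
  by rewrite e1 hR; field; rewrite ?B0 ?two0.
rewrite {}hL0 {}hL1; field; rewrite ?A0 ?B0 ?C0 ?x0 ?two0//.
Unshelve. all: by end_near. Qed.

Lemma vy_zeta_rec m n x :
  x != 0 -> (Q m).[x] != 0 -> (Q m.+1).[x] != 0 -> (Q m.+2).[x] != 0 ->
  vy_zeta m n x = - vy_ell m.+1 n.+1 x
    + conv ((vy_ell m.+1)^~ x) ((vy_zeta m)^~ x) n.
Proof.
move=> x0 q0 q1 q2.
have Omx : Om m x by rewrite /Om /= !hornerM hornerX !mulf_neq0.
have oOm : open (Om m) by exact: open_horner_neq0.
have jz : is_jet (Om m) (vy_zeta m).
  apply: is_jetD; last exact: is_jetZ.
  apply: is_jetD; last by apply: is_jetZ; apply: jet_v => y /OmE[].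
  by apply: is_jetD; apply: jet_v => y /OmE[].
have je : is_jet (Om m) (vy_ell m.+1) by apply: is_jetZ; exact: is_jet_conv.
have jr := is_jetD _ _ _ (is_jetZ _ (-1) _ (is_jetS _ _ je)) (is_jet_conv _ _ _ je jz).
have := is_jet_uniq _ _ _ oOm jz jr _ n x Omx.
rewrite mulN1r; apply => y Omy.
by rewrite conv0 mulN1r; exact: vy_zeta0.
Qed.

End Recursion.

(** * The majorant *)

(** Here [z] is the jet of -ell'/(1 - ell). In the convolution the term with [z n] itself has
    coefficient of modulus at most [eta] and is absorbed on the left; the others have lower order.
    With [eta] <= 1/16 the quadratic error is at most the main term, whence the factor 2. *)
Lemma conv_quotient_bound (R : realType) (ell z : nat -> Cplx R) (psi : nat -> R) (eta : R) :
  (forall n, 0 <= psi n) -> psi 0%N = 1 ->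
  (forall n, conv psi psi n <= 8 * psi n) -> 0 <= eta <= 16^-1 ->
  (forall n, cnorm (ell n) <= eta * psi n) ->
  (forall n, z n = - ell n.+1 + conv ell z n) ->
  forall n, cnorm (z n) <= 2 * eta * psi n.+1.
Proof.
move=> psi0 psi1 hpsi /andP[eta0 eta16] hell hz n.
elim/ltn_ind: n => n IH.
pose S := \sum_(i < n) (eta * psi i.+1) * (2 * eta * psi (n - i.+1).+1) *+ 'C(n, i.+1).
have zS : cnorm (z n) <= eta * psi n.+1 + (eta * cnorm (z n) + S).
  rewrite {1}hz; apply: le_trans (cnormD _ _) _; rewrite cnormN.
  apply: lerD => //; rewrite /conv big_ord_recl bin0 mulr1n subn0.
  apply: le_trans (cnormD _ _) _; apply: lerD.
    by rewrite cnormM ler_wpM2r ?cnorm_ge0//; have := hell 0%N; rewrite psi1 mulr1.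
  rewrite /S; elim/big_rec2: _ => [|i y x _ h]; first by rewrite cnorm0.
  apply: le_trans (cnormD _ _) _; apply: lerD h; rewrite lift0.
  rewrite -[_ *+ _]mulr_natr -[leRHS]mulr_natr !cnormM cnorm_nat ler_wpM2r//.
  apply: ler_pM; rewrite ?cnorm_ge0//.
  by apply: IH; have := ltn_ord i; lia.
have SE : S = 2 * eta ^+ 2 * (conv psi (fun i => psi i.+1) n - psi n.+1).
  rewrite /conv big_ord_recl bin0 psi1 mul1r mulr1n subn0 addrC addKr mulr_sumr.
  apply: eq_bigr => i _; rewrite lift0 -[LHS]mulr_natr -[X in _ = _ * X]mulr_natr; ring.
(* This is one of the two nonnegative halves of the Leibniz rule for [conv psi psi n.+1]. *)
have cle : conv psi (fun i => psi i.+1) n <= 8 * psi n.+1.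
  apply: le_trans (hpsi n.+1); rewrite convS lerDr.
  by apply: sumr_ge0 => i _; rewrite mulrn_wge0// mulr_ge0.
have p0 := psi0 n.+1.
have : (1 - eta) * cnorm (z n) <= (1 - eta) * (2 * eta * psi n.+1).
  have : 2 * eta ^+ 2 * conv psi (fun i => psi i.+1) n <= 2 * eta ^+ 2 * (8 * psi n.+1).
    by rewrite ler_wpM2l// mulr_ge0 ?sqr_ge0.
  have : eta * psi n.+1 * eta <= eta * psi n.+1 * 16^-1.
    by rewrite ler_wpM2l// mulr_ge0.
  move: zS; rewrite SE; set c := conv _ _ _; set p := psi _; set x := cnorm _.
  by rewrite expr2; lra.
by rewrite ler_pM2l//; lra.
Qed.

Section Majorants.
Context {R : realType}.
(* [rho] is the modulus of the point, [mu] is [1/M] with [M] the last index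
   considered, [theta] is of order [1 / rho] and [lam] of order [M / rho]. *)
Variables (N : nat) (rho theta mu lam q : R).
Hypotheses (N1 : (1 <= N)%N) (rho0 : 0 < rho)
  (theta_rho : theta * rho = 2 ^+ N.*2.+3) (mu01 : 0 <= mu <= 1)
  (lam0 : 0 <= lam) (lam_mu : lam * mu = theta) (qE : q = expR (4 * mu)).

Definition vy_base k : R :=
  lam ^+ 2 * wseq (fun k => tau k ^+ N.*2) theta k.

(* Majorant of the [k]-th derivative of the potential of [Q_m]. *)
Definition vy_maj m k : R := vy_base k * q ^+ (m * k.+2).

(** [jetw] of weight 2N without its factor [lam ^+ N.*2], hence equal to 1 at k = 0. *)
Definition vy_psi m k : R :=
  wseq (fun k => tau k ^+ N.*2 * (1 + k%:R * mu) ^+ N.*2) (theta * q ^+ m) k.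

Let mu_ge0 : 0 <= mu. Proof. by case/andP: mu01. Qed.

Let theta_ge0 : 0 <= theta. Proof. by rewrite -lam_mu mulr_ge0. Qed.

Let q_ge1 : 1 <= q.
Proof. by rewrite qE -expR0 ler_expR mulr_ge0. Qed.

Let q_ge0 : 0 <= q. Proof. exact: le_trans ler01 q_ge1. Qed.

Lemma vy_q_le m : m%:R * mu <= 1 -> q ^+ m <= expR 4.
Proof.
by move=> mM; rewrite qE -expRM_natr ler_expR -mulrA ler_piMr// mulrC.
Qed.

Lemma vy_base_ge0 k : 0 <= vy_base k.
Proof.
by rewrite mulr_ge0 ?sqr_ge0// wseq_ge0// => i; rewrite exprn_ge0 ?tau_ge0.
Qed.

Lemma vy_maj_ge0 m k : 0 <= vy_maj m k.
Proof. by rewrite mulr_ge0 ?vy_base_ge0 ?exprn_ge0. Qed.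

Lemma vy_maj_le_jetw m k : m%:R * mu <= 1 ->
  vy_maj m k <= expR 8 * jetw N lam (theta * q ^+ m) mu 2 k.
Proof.
move=> mM; rewrite /vy_maj /vy_base /jetw /wseq.
rewrite -(addn2 k) mulnDr [q ^+ _]exprD [(theta * _) ^+ k]exprMn -[_ ^+ m ^+ k]exprM.
have qm : q ^+ (m * 2) <= expR 8.
  rewrite exprM (_ : 8 = 4 * 2%:R); last by ring.
  by rewrite expRM_natr lerXn2r ?nnegrE ?exprn_ge0 ?expR_ge0 ?vy_q_le.
have b1 : 1 <= (1 + k%:R * mu) ^+ 2.
  by rewrite exprn_ege1// lerDl mulr_ge0.
set x := lam ^+ 2; set f := k`!%:R; set t := tau k ^+ 2; set v := tau k ^+ N.*2.
set w := theta ^+ k; set c := q ^+ (m * k).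
have -> : x * (f * (t * v * w)) * (c * q ^+ (m * 2)) = (x * (f * (t * v * (w * c)))) * (q ^+ (m * 2) * 1) by ring.
have -> : expR 8 * (x * (f * (t * (v * (1 + k%:R * mu) ^+ 2) * (w * c)))) =
  (x * (f * (t * v * (w * c)))) * (expR 8 * (1 + k%:R * mu) ^+ 2) by ring.
rewrite ler_wpM2l ?mulr_ge0 ?sqr_ge0 ?exprn_ge0 ?tau_ge0//.
by apply: ler_pM; rewrite ?exprn_ge0.
Qed.

Lemma vy_kappa_le m : m%:R * mu <= 1 -> theta * q ^+ m <= expR 8 * lam * mu.
Proof.
move=> mM; rewrite -mulrA lam_mu mulrC ler_wpM2r//.
by apply: le_trans (vy_q_le _ mM) _; rewrite ler_expR; lra.
Qed.

Lemma vy_lambda_y k : lam * (k.+2%:R * mu) = theta * k.+2%:R.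
Proof. by rewrite mulrCA lam_mu mulrC. Qed.

Lemma vy_psi_ge0 m k : 0 <= vy_psi m k.
Proof.
rewrite wseq_ge0 ?mulr_ge0 ?exprn_ge0// => i.
by rewrite mulr_ge0 ?exprn_ge0 ?tau_ge0 ?addr_ge0 ?mulr_ge0.
Qed.

Lemma vy_psi0 m : vy_psi m 0 = 1.
Proof. by rewrite /vy_psi /wseq tau0 mul0r addr0 !expr1n !expr0 fact0 !mulr1. Qed.

(** Dividing by 1 - ell requires products that do not double the weight. The factor [tau k ^+ N.*2]
    achieves this: (1 + k mu)/(k + 1) is submultiplicative for 0 <= mu <= 1, although 1 + k mu is
    not. *)
Lemma conv_vy_psi_le m n : conv (vy_psi m) (vy_psi m) n <= 8 * vy_psi m n.
Proof.
have h k : 0 <= tau k * (1 + k%:R * mu) by rewrite mulr_ge0 ?tau_ge0 ?addr_ge0 ?mulr_ge0.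
apply: conv_wseq_le; rewrite ?mulr_ge0 ?exprn_ge0 ?tau_ge0 ?addr_ge0 ?mulr_ge0// => i j.
rewrite -!exprMn lerXn2r ?nnegrE ?(mulr_ge0 (h i) (h j)) ?h//.
rewrite /tau -[i.+1%:R]natr1 -[j.+1%:R]natr1 -[(i + j).+1%:R]natr1 natrD.
have : 0 <= i%:R :> R by []. have : 0 <= j%:R :> R by [].
move: i%:R j%:R => x y y0 x0.
have -> : (x + 1)^-1 * (1 + x * mu) * ((y + 1)^-1 * (1 + y * mu)) =
  ((1 + x * mu) * (1 + y * mu)) / ((x + 1) * (y + 1)).
  by field; apply/andP; split; lra.
rewrite ler_pdivrMr ?mulr_gt0//; [|lra..].
rewrite -mulrA [leRHS]mulrC ler_pdivlMr; last by lra.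
have : 0 <= x * y * ((1 - mu * mu) + (x + y) * mu * (1 - mu)).
  have /andP[_ mu1] := mu01.
  have mm : mu * mu <= 1 by rewrite mulr_ile1.
  have a : 0 <= 1 - mu * mu by lra.
  have b : 0 <= (x + y) * mu * (1 - mu).
    by apply: mulr_ge0; [apply: mulr_ge0 => //; apply: addr_ge0|lra].
  by apply: mulr_ge0; [exact: mulr_ge0|exact: addr_ge0].
by lra.
Qed.

(* The next bounds compare the second difference of [vy_maj] in [m], a multiple
   of [sinh (2 y) ^ 2] at [y = k.+2 / M], with the powers of [y] produced by
   differentiating with respect to [x]. *)
Lemma expR4B1_ge (y : R) : 0 <= y ->
  expR (2 * y) * (y * expR y) <= expR (4 * y) - 1.
Proof.
move=> y0; have -> : 4 * y = y + y + (y + y) by ring.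
have -> : 2 * y = y + y by ring.
have h := expR_ge1Dx y; rewrite !expRD.
set e := expR y in h *; have e1 : 1 <= e by lra.
have e2 : 1 <= e * e by rewrite mulr_ege1.
have e3 : y * e <= (e - 1) * e by apply: ler_wpM2r; lra.
have : e * e * (y * e) <= e * e * ((e - 1) * e) by apply: ler_wpM2l => //; lra.
by move=> /le_trans; apply; nra.
Qed.

(** Comes from (1+y)^N / N! <= exp(1+y), squared. *)
Definition vy_gap : R := (N`!%:R * expR 1) ^- 2.

Lemma vy_gap_gt0 : 0 < vy_gap.
Proof. by rewrite invr_gt0 exprn_gt0// mulr_gt0 ?expR_gt0// ltr0n fact_gt0. Qed.

Lemma expR_sqr_ge (y : R) : 0 <= y -> vy_gap * (1 + y) ^+ N.*2 <= expR y ^+ 2.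
Proof.
move=> y0; rewrite -muln2 exprM /vy_gap -exprVn -exprMn.
have fe : 0 < N`!%:R * expR 1 :> R by rewrite mulr_gt0 ?expR_gt0// ltr0n fact_gt0.
rewrite lerXn2r ?nnegrE ?expR_ge0 ?mulr_ge0 ?invr_ge0 ?exprn_ge0 ?addr_ge0 ?expR_ge0//.
rewrite mulrC ler_pdivrMr//.
have := @expR_ge1Dxn R (1 + y) N.-1; rewrite prednK// => /(_ ltac:(lra)).
have f0 : 0 < N`!%:R :> R by rewrite ltr0n fact_gt0.
move=> h; have : (1 + y) ^+ N / N`!%:R <= expR (1 + y) by lra.
by rewrite ler_pdivrMr// expRD; nra.
Qed.

Local Notation y k := (k.+2%:R * mu).

Lemma vy_qX k : q ^+ k.+2 = expR (4 * y k).
Proof. by rewrite qE -expRM_natr; congr expR; ring. Qed.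

(** The second difference is the term at index m times (exp(4y) - 1)^2, which is at least exp(4y)
    y^2 exp(2y). The factor exp(4y) moves the index to m+1, y^2 pays for two derivatives, and
    exp(2y) is left to dominate [c]. *)
Lemma vy_maj_diff2 m k (c : R) : c <= expR (y k) ^+ 2 ->
  vy_base k * q ^+ (m.+1 * k.+2) * ((y k) ^+ 2 * c)
   <= vy_maj m.+2 k - 2 * vy_maj m.+1 k + vy_maj m k.
Proof.
move=> hc; rewrite /vy_maj !mulSn !exprD.
set Q := q ^+ (m * k.+2); rewrite vy_qX; set e := expR (4 * y k).
have y0 : 0 <= y k by rewrite mulr_ge0.
have -> : vy_base k * (e * (e * Q)) - 2 * (vy_base k * (e * Q)) + vy_base k * Q =
   vy_base k * Q * (e - 1) ^+ 2 by ring.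
have -> : vy_base k * (e * Q) * (y k ^+ 2 * c) = vy_base k * Q * (e * (y k ^+ 2 * c)) by ring.
rewrite ler_wpM2l ?(mulr_ge0 (vy_base_ge0 k)) ?exprn_ge0//.
have := expR4B1_ge _ y0; rewrite -/e.
have -> : e = expR (2 * y k) ^+ 2.
  by rewrite /e -expRM_natl; congr expR; ring.
set d := expR (2 * _); have d0 : 0 <= d by exact: expR_ge0.
have p0 : 0 <= d * (y k * expR (y k)).
  by apply: mulr_ge0 => //; apply: mulr_ge0 => //; exact: expR_ge0.
move=> h; have : (d * (y k * expR (y k))) ^+ 2 <= (d ^+ 2 - 1) ^+ 2.
  by rewrite lerXn2r ?nnegrE ?(le_trans p0 h).
move=> h2; apply: le_trans h2.
by rewrite !exprMn ler_wpM2l ?sqr_ge0// ler_wpM2l ?mulr_ge0 ?sqr_ge0.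
Qed.

Lemma exp2_ge k : k.+1%:R <= 2 ^+ k :> R.
Proof.
elim: k => [|k IH]; first by rewrite expr0.
by rewrite exprS -natr1 mulr_natl mulr2n lerD// exprn_ege1// ler1n.
Qed.

Lemma factS_rho_le k :
  2 * ((k.+1)`!%:R / rho ^+ k.+2) <= 2^-1 * (vy_base k * (y k) ^+ 2).
Proof.
have -> : vy_base k * (y k) ^+ 2 = (lam * y k) ^+ 2 * wseq (fun k => tau k ^+ N.*2) theta k.
  by rewrite /vy_base; ring.
rewrite vy_lambda_y /wseq factS natrM.
have rk : 0 < rho ^+ k.+2 by rewrite exprn_gt0.
rewrite mulrA ler_pdivrMr//.
pose sigma : R := 2 ^+ N.*2.+3.
have hs : theta ^+ k * theta ^+ 2 * rho ^+ k.+2 = sigma ^+ k * sigma ^+ 2.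
  by rewrite -!exprD addn2 -exprMn theta_rho.
have -> : 2^-1 * ((theta * k.+2%:R) ^+ 2 * (k`!%:R * (tau k ^+ 2 * tau k ^+ N.*2 * theta ^+ k))) * rho ^+ k.+2
   = 2^-1 * (k`!%:R * (k.+2%:R ^+ 2 * tau k ^+ N.*2.+2)) * (theta ^+ k * theta ^+ 2 * rho ^+ k.+2).
  by rewrite -(addn2 N.*2) [tau k ^+ (_ + _)]exprD; ring.
rewrite hs.
have t0 : 0 < k.+1%:R :> R by rewrite ltr0n.
(* Origin of the exponent 2N+3 in [theta * rho]: 2^k >= k+1, so [sigma ^+ k] beats (k+1)^(2N+3). *)
have h : k.+1%:R <= tau k ^+ N.*2.+2 * sigma ^+ k.
  rewrite /tau exprVn mulrC ler_pdivlMr ?exprn_gt0// -exprS /sigma.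
  rewrite -exprM mulnC exprM lerXn2r ?nnegrE ?exprn_ge0//.
  exact: exp2_ge.
have s2 : 4 <= sigma ^+ 2.
  apply: le_trans (_ : 2 ^+ 2 <= _); first by rewrite expr2; lra.
  rewrite lerXn2r ?nnegrE ?exprn_ge0// /sigma exprS ler_peMr//.
  by rewrite exprn_ege1// ler1n.
have k2 : 1 <= k.+2%:R ^+ 2 :> R by rewrite exprn_ege1// ler1n.
have f0 : 0 <= k`!%:R :> R by [].
move: (tau k ^+ _) (sigma ^+ k) (sigma ^+ 2) s2 (k.+2%:R ^+ 2) k2 (k`!%:R) f0 h => t s u u4 z z1 f f0 h.
have -> : 2^-1 * (f * (z * t)) * (s * u) = f * ((2^-1 * (z * u)) * (t * s)) by ring.
rewrite (_ : 2 * (_ * f) = f * (2 * k.+1%:R)); last by ring.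
rewrite ler_wpM2l//.
have zs : 4 <= z * u by rewrite -[4]mul1r; apply: ler_pM.
have : 2 * (t * s) <= 2^-1 * (z * u) * (t * s) by apply: ler_wpM2r; lra.
lra.
Qed.

(** Two more derivatives cost theta^2 (k+1)(k+2), which is at most (lam y)^2 = theta^2 (k+2)^2
    because [lam * mu] is [theta]. *)
Lemma vy_psi_le m k :
  vy_psi m k.+2 <= vy_base k * q ^+ (m * k.+2) * ((y k) ^+ 2 * (1 + y k) ^+ N.*2).
Proof.
have -> : vy_base k * q ^+ (m * k.+2) * ((y k) ^+ 2 * (1 + y k) ^+ N.*2) =
   (lam * y k) ^+ 2 * wseq (fun k => tau k ^+ N.*2) theta k * q ^+ (m * k.+2) * (1 + y k) ^+ N.*2.
  by rewrite /vy_base; ring.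
rewrite vy_lambda_y /vy_psi /wseq exprMn -exprM !factS !natrM.
rewrite -[theta ^+ k.+2]/(theta ^+ (2 + k)) exprD.
set b := (1 + _) ^+ N.*2; set Q := q ^+ _; set f := k`!%:R; set h := theta ^+ k.
have -> : k.+2%:R * (k.+1%:R * f) * (tau k.+2 ^+ 2 * (tau k.+2 ^+ N.*2 * b) * (theta ^+ 2 * h * Q)) =
  (f * b * theta ^+ 2 * h * Q) * (k.+2%:R * k.+1%:R * (tau k.+2 ^+ 2 * tau k.+2 ^+ N.*2)) by ring.
have -> : (theta * k.+2%:R) ^+ 2 * (f * (tau k ^+ 2 * tau k ^+ N.*2 * h)) * Q * b =
  (f * b * theta ^+ 2 * h * Q) * (k.+2%:R * k.+2%:R * (tau k ^+ 2 * tau k ^+ N.*2)) by ring.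
have t n : tau k.+2 ^+ n <= tau k ^+ n :> R.
  by rewrite lerXn2r ?nnegrE ?tau_ge0// tau_le// -addn2 leq_addr.
rewrite ler_wpM2l ?mulr_ge0 ?exprn_ge0 ?addr_ge0 ?mulr_ge0//.
apply: ler_pM; rewrite ?mulr_ge0 ?exprn_ge0 ?tau_ge0//.
  by rewrite ler_wpM2l// ler_nat.
by apply: ler_pM; rewrite ?exprn_ge0 ?tau_ge0.
Qed.

Lemma vy_maj_diff1 k : vy_base k * (y k) ^+ 2 <= vy_maj 1 k - vy_maj 0 k.
Proof.
rewrite /vy_maj mul1n mul0n expr0 mulr1 -[X in _ - X]mulr1 -mulrBr.
rewrite ler_wpM2l ?vy_base_ge0// vy_qX.
have y0 : 0 <= y k by rewrite mulr_ge0.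
apply: le_trans (expR4B1_ge _ y0).
have e2 : 1 <= expR (2 * y k) by rewrite -[leLHS]expR0 ler_expR; exact: mulr_ge0.
have e1 : y k <= expR (y k) by apply: le_trans (expR_ge1Dx _); rewrite lerDr.
rewrite expr2 -[leLHS]mul1r; apply: ler_pM; rewrite ?(mulr_ge0 y0 y0)//.
exact: ler_wpM2l.
Qed.

Lemma fact_rho_le_jetw m k :
  k`!%:R / rho ^+ k.+1 <= rho^-1 * jetw N lam (theta * q ^+ m) mu 0 k.
Proof.
rewrite /jetw /wseq !expr0 mul1r mulr1 exprS invfM mulrCA ler_wpM2l ?invr_ge0 ?(ltW rho0)//.
rewrite ler_wpM2l// -exprD add2n.
have rk : 0 < rho ^+ k by rewrite exprn_gt0.
rewrite -[leLHS]mul1r ler_pdivrMr// -mulrA -exprMn /tau exprVn mulrC.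
rewrite ler_pdivlMr ?exprn_gt0// mul1r.
apply: le_trans (_ : k.+1%:R ^+ N.*2.+3 <= _).
  by rewrite [leRHS]exprS ler_peMl ?exprn_ge0// ler1n.
apply: le_trans (_ : (theta * rho) ^+ k <= _).
  by rewrite theta_rho -exprM mulnC exprM lerXn2r ?nnegrE ?exprn_ge0 ?exp2_ge.
rewrite mulrAC lerXn2r ?nnegrE ?mulr_ge0 ?exprn_ge0 ?(ltW rho0)//.
by rewrite ler_peMr ?mulr_ge0 ?(ltW rho0)// exprn_ege1.
Qed.

Variables (L : nat -> dpoly (Cplx R)) (Q : nat -> {poly Cplx R}) (C : R) (x : Cplx R).
Hypotheses (hQ : is_higher_VY N L Q) (C0 : 0 <= C)
  (rhoE : rho = cnorm x).
Hypothesis hC : forall (la ka mu : R) (s : nat -> Cplx R),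
  0 <= la -> 0 <= ka -> 0 <= mu <= 1 -> ka <= expR 8 * la * mu ->
  (forall n, cnorm (s n) <= expR 8 * jetw N la ka mu 2 n) ->
  forall j, (j <= N)%N -> forall n,
    cnorm (djet s (L j) n) <= C * jetw N la ka mu j.*2 n.

Let eta : R := 16 * C * lam ^+ N.*2 / rho.
Hypotheses (eta16 : eta <= 16^-1) (eta_gap : 8 * eta <= vy_gap).

Let x0 : x != 0.
Proof. by rewrite -cnorm_eq0 -rhoE gt_eqF. Qed.

Let eta0 : 0 <= eta.
Proof. by rewrite divr_ge0 ?mulr_ge0 ?exprn_ge0 ?(ltW rho0). Qed.

Lemma cnorm_inv_jet n : cnorm (inv_jet n x) = n`!%:R / rho ^+ n.+1.
Proof.
rewrite inv_jetE// !cnormM cnormV !cnormX cnormN cnorm1 expr1n mul1r cnorm_nat.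
by rewrite rhoE.
Qed.

Lemma cnorm_vy_ell_le m : m%:R * mu <= 1 ->
  (forall n, cnorm (vy_jet Q m n x) <= vy_maj m n) ->
  forall n, cnorm (vy_ell N L Q m n x) <= eta * vy_psi m n.
Proof.
move=> mM hm n; pose ka := theta * q ^+ m.
have ka0 : 0 <= ka by rewrite mulr_ge0 ?exprn_ge0.
have hs k : cnorm (vy_jet Q m k x) <= expR 8 * jetw N lam ka mu 2 k.
  by apply: le_trans (hm k) _; exact: vy_maj_le_jetw.
have hl := hC lam ka mu _ lam0 ka0 mu01 (vy_kappa_le _ mM) hs N (leqnn N).
have hi k : cnorm (inv_jet k x) <= rho^-1 * jetw N lam ka mu 0 k.
  by rewrite cnorm_inv_jet; exact: fact_rho_le_jetw.
have r0 : 0 <= rho^-1 by rewrite invr_ge0 ltW.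
rewrite /vy_ell cnormM cnorm_nat.
have -> : eta * vy_psi m n = 2 * (8 * rho^-1 * C * jetw N lam ka mu N.*2 n).
  by rewrite /eta /vy_psi /jetw; ring.
rewrite ler_wpM2l//.
exact: (cnorm_conv_jetw N lam ka mu lam0 ka0 mu01 _ _ _ _ 0 N.*2 _ hi hl r0 C0 erefl).
Qed.

(** A zero of Q_(m+2) at x would force 2 L_N[u_(m+1)](x) = x, so that ell would have modulus 1
    there, against the bound [eta] <= 1/16. *)
Lemma vy_next_neq0 m : m.+1%:R * mu <= 1 ->
  (Q m).[x] != 0 -> (Q m.+1).[x] != 0 ->
  (forall n, cnorm (vy_jet Q m.+1 n x) <= vy_maj m.+1 n) ->
  (Q m.+2).[x] != 0.
Proof.
move=> mM q0 q1 hm; apply/eqP => q2.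
have [_ _ hrec] := hQ.
have := hrec m.+1 x isT q1; rewrite q2 mul0r => /esym/eqP.
rewrite mulf_eq0 expf_eq0 (negPf q1) /= subr_eq0 => /eqP xE.
have := cnorm_vy_ell_le _ mM hm 0; rewrite vy_psi0 mulr1.
rewrite /vy_ell conv0 inv_jetE// expr0 fact0 mul1r expr1 mul1r.
rewrite -[lenard_jet _ _ _ _ _ _]/(dpoly_eval (L N) (VY_potential (Q m.+1)) x).
rewrite mulrCA -xE mulVf// cnorm1 => h.
by have := le_trans h eta16; lra.
Qed.

Lemma cnorm_vy_jet_diff2_le m n : m.+1%:R * mu <= 1 ->
  (Q m).[x] != 0 -> (Q m.+1).[x] != 0 ->
  (forall n, cnorm (vy_jet Q m.+1 n x) <= vy_maj m.+1 n) ->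
  cnorm (vy_jet Q m.+2 n x - 2 * vy_jet Q m.+1 n x + vy_jet Q m n x) <=
    vy_maj m.+2 n - 2 * vy_maj m.+1 n + vy_maj m n.
Proof.
move=> mM q0 q1 hm; have q2 := vy_next_neq0 _ mM q0 q1 hm.
rewrite vy_jet_diff2//.
have hz := conv_quotient_bound R (fun k => vy_ell N L Q m.+1 k x)
  (fun k => vy_zeta Q m k x) (vy_psi m.+1) eta (vy_psi_ge0 m.+1) (vy_psi0 m.+1)
  (conv_vy_psi_le m.+1) _ (cnorm_vy_ell_le _ mM hm)
  (fun k => vy_zeta_rec N L Q hQ m k x x0 q0 q1 q2).
rewrite eta0 eta16 in hz; have {hz} hz := hz isT n.+1.
rewrite cnormM cnorm_nat.
apply: le_trans (ler_wpM2l _ (cnormD _ _)) _ => //.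
rewrite mulrDr cnorm_inv_jet.
have y0 : 0 <= y n by rewrite mulr_ge0.
(* Half of [D] covers the derivatives of 1/x (case c = 1), the other half those of [vy_zeta] (case c
   = [vy_gap] (1+y)^(2N)). *)
set D := vy_maj m.+2 n - _ + _.
have D1 : vy_base n * q ^+ (m.+1 * n.+2) * ((y n) ^+ 2 * 1) <= D.
  apply: vy_maj_diff2; rewrite exprn_ege1// -[leLHS]expR0 ler_expR//.
have D2 : vy_base n * q ^+ (m.+1 * n.+2) * ((y n) ^+ 2 * (vy_gap * (1 + y n) ^+ N.*2)) <= D.
  by apply: vy_maj_diff2; exact: expR_sqr_ge.
have B0 : 0 <= vy_base n * (y n) ^+ 2 by rewrite (mulr_ge0 (vy_base_ge0 n)) ?sqr_ge0.
have h1 : 2 * ((n.+1)`!%:R / rho ^+ n.+2) <= 2^-1 * D.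
  apply: le_trans (factS_rho_le n) _; rewrite ler_wpM2l ?invr_ge0//.
  apply: le_trans D1; rewrite mulr1 [leRHS]mulrAC ler_peMr//.
  exact: exprn_ege1.
have h2 : 2 * cnorm (vy_zeta Q m n.+1 x) <= 2^-1 * D.
  have p := vy_psi_le m.+1 n.
  have z : 2 * cnorm (vy_zeta Q m n.+1 x) <= 4 * eta * (vy_base n * q ^+ (m.+1 * n.+2) *
      ((y n) ^+ 2 * (1 + y n) ^+ N.*2)).
    rewrite (_ : 4 * eta = 2 * (2 * eta)); last by ring.
    rewrite -mulrA ler_wpM2l//; apply: le_trans hz _.
    by rewrite ler_wpM2l// mulr_ge0.
  apply: le_trans z _.
  apply: le_trans (_ : 2^-1 * (vy_base n * q ^+ (m.+1 * n.+2) * ((y n) ^+ 2 * (vy_gap * (1 + y n) ^+ N.*2))) <= _); last first.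
    by rewrite ler_wpM2l ?invr_ge0.
  set P := (1 + y n) ^+ _; set B := vy_base n * _; set Y := y n ^+ 2.
  have -> : 2^-1 * (B * (Y * (vy_gap * P))) = 2^-1 * vy_gap * (B * (Y * P)) by ring.
  have quarter (a b : R) : 8 * a <= b -> 4 * a <= 2^-1 * b by lra.
  apply: ler_wpM2r; last exact: quarter.
  apply: mulr_ge0; first exact: mulr_ge0 (vy_base_ge0 n) (exprn_ge0 _ q_ge0).
  by apply: mulr_ge0; [exact: sqr_ge0|apply: exprn_ge0; exact: addr_ge0].
lra.
Qed.

Lemma vy_jet0 n : vy_jet Q 0 n x = 0.
Proof.
have [Q0 _ _] := hQ.
have q0 : (Q 0%N).[x] != 0 by rewrite Q0 hornerC oner_neq0.
rewrite /vy_jet derive1n_VY_potential//.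
have j : is_jet setT (fun (_ : nat) (_ : Cplx R) => 0 : Cplx R).
  by move=> k y _; exact: is_derive_cst.
rewrite (is_jet_derive1n _ _ _ openT j) ?mulr0// => y _.
by rewrite Q0 /log_deriv -polyC1 derivC horner0 mul0r.
Qed.

(** The equation is of second order in m, so the induction carries the first difference along with
    the value; bounds on second differences then sum up by telescoping. *)
Lemma vy_majorized m : m%:R * mu <= 1 ->
  [/\ (Q m).[x] != 0, (Q m.+1).[x] != 0,
    forall n, cnorm (vy_jet Q m n x) <= vy_maj m n &
    forall n, cnorm (vy_jet Q m.+1 n x - vy_jet Q m n x) <= vy_maj m.+1 n - vy_maj m n].
Proof.
have [Q0 Q1 hrec] := hQ.
elim: m => [|m IH] mM.
  split=> [||n|n]; rewrite ?Q0 ?Q1 ?hornerC ?hornerX ?oner_eq0//.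
    by rewrite vy_jet0 cnorm0 vy_maj_ge0.
  rewrite vy_jet0 subr0 /vy_jet Q1 derive1n_VY_potential ?hornerX//.
  rewrite cnormM cnorm_nat -[derive1n _ _ _]/(inv_jet n.+1 x) cnorm_inv_jet.
  apply: le_trans (factS_rho_le n) _; apply: le_trans (vy_maj_diff1 n).
  have y0 : 0 <= y n by rewrite mulr_ge0.
  have : 0 <= vy_base n * (y n) ^+ 2 by rewrite (mulr_ge0 (vy_base_ge0 n)) ?sqr_ge0.
  lra.
have mM' : m%:R * mu <= 1.
  by apply: le_trans mM; rewrite ler_wpM2r// ler_nat.
have [q0 q1 h0 h1] := IH mM'.
have h n : cnorm (vy_jet Q m.+1 n x) <= vy_maj m.+1 n.
  rewrite -[vy_jet Q m.+1 n x](subrK (vy_jet Q m n x)).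
  apply: le_trans (cnormD _ _) _.
  by have := lerD (h1 n) (h0 n); rewrite subrK.
split=> [//||//|n]; first exact: vy_next_neq0 mM q0 q1 h.
have telescope (a b c : Cplx R) : a - b = (a - 2 * b + c) + (b - c) by ring.
rewrite (telescope _ _ (vy_jet Q m n x)).
apply: le_trans (cnormD _ _) _.
apply: le_trans (lerD (cnorm_vy_jet_diff2_le _ n mM q0 q1 h) (h1 n)) _.
have telescope' (a b c : R) : (a - 2 * b + c) + (b - c) = a - b by ring.
by rewrite telescope'.
Qed.

End Majorants.

(** * Disks *)

Section Disk.
Context {R : realType}.

Definition disk (r : R) : set (Cplx R) := [set x | cnorm x < r].

Lemma open_disk r : open (disk r).
Proof.
have -> : disk r = ball (0 : Cplx R) (toC r).
  apply/seteqP; split=> x; rewrite -ball_normE /= sub0r normrN -toC_cnorm toC_lt//.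
exact: ball_open.
Qed.

Lemma toC_continuous : continuous (@toC R : R -> Cplx R).
Proof.
move=> a; apply/cvgrPdist_lt => e e0.
have eE : e = toC (cnorm e) by rewrite toC_cnorm gtr0_norm.
have ce0 : 0 < cnorm e by rewrite -toC_lt -eE toC0.
near=> b.
have -> : toC a - toC b = toC (a - b) by rewrite /toC -raddfB.
rewrite -toC_cnorm eE toC_lt.
have -> : cnorm (toC (a - b)) = `|a - b|.
  apply: toC_inj; rewrite toC_cnorm /toC normc_def /= expr0n /= addr0 sqrtr_sqr//.
near: b; exact: cvgr_dist_lt.
Unshelve. all: by end_near. Qed.

Lemma connected_disk r : connected (disk r).
Proof.
have [r0|r0] := leP r 0.
  rewrite (_ : disk r = set0); first exact: connected0.
  by apply/seteqP; split=> x //=; rewrite /disk /= ltNge (le_trans r0)// cnorm_ge0.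
pose seg (x : Cplx R) : set (Cplx R) := (fun t : R => toC t * x) @` `[0, 1].
have -> : disk r = \bigcup_(x in disk r) seg x.
  apply/seteqP; split=> [x xr|y [x xr [t /=]]].
    by exists x => //; exists 1; rewrite /= ?in_itv /= ?lexx ?ler01// toC1 mul1r.
  rewrite in_itv /= => /andP[t0 t1] <-.
  rewrite /disk /= cnormM cnorm_toC//; apply: le_lt_trans xr.
  by rewrite ler_piMl ?cnorm_ge0.
apply: bigcup_connected => [|x xr].
  exists 0 => x xr; exists 0; rewrite /= ?in_itv /= ?lexx ?ler01//.
  by rewrite toC0 mul0r.
apply: connected_continuous_connected; first exact: segment_connected.
apply: continuous_subspaceT => t.
by apply: cvgM; [exact: toC_continuous|exact: cvg_cst].
Qed.

(** The closed disk lies in a square, a continuous image of a product of two real segments. *)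
Lemma compact_closure_disk r : compact (closure (disk r)).
Proof.
pose f (p : R * R) : Cplx R := toC p.1 + ('i)%C * toC p.2.
pose sq := f @` (`[- r, r] `*` `[- r, r]).
have csq : compact sq.
  apply: continuous_compact; last by apply: compact_setX; exact: segment_compact.
  apply: continuous_subspaceT => p; apply: cvgD.
    by apply: (cvg_comp _ _ (@cvg_fst _ _ _ _ _)); exact: toC_continuous.
  apply: cvgM; first exact: cvg_cst.
  by apply: (cvg_comp _ _ (@cvg_snd _ _ _ _ _)); exact: toC_continuous.
apply: (subclosed_compact _ csq); first exact: closed_closure.
rewrite closureE; apply: smallest_sub.
  by apply: compact_closed csq; exact: norm_hausdorff.
move=> x /= xr; exists (complex.Re x, complex.Im x) => /=; last first.
  by rewrite /f /toC [RHS]complexE.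
have : cnorm x < r by [].
rewrite /cnorm normc_def /= => sr.
have b (a : R) : a ^+ 2 <= complex.Re x ^+ 2 + complex.Im x ^+ 2 -> - r <= a <= r.
  move=> h; rewrite -ler_norml -sqrtr_sqr; apply: le_trans (ltW sr).
  exact: ler_wsqrtr.
by split; rewrite /= in_itv /=; apply: b; rewrite ?lerDl ?lerDr sqr_ge0.
Qed.

Lemma compact_region_closure_disk r : 0 < r -> compact_region (closure (disk r)).
Proof.
move=> r0; split; first exact: compact_closure_disk.
exists (disk r); split=> //; [exact: open_disk|exact: connected_disk|].
by exists 0; rewrite /disk /= cnorm0.
Qed.

End Disk.

(** * Uniform bound on the scaled roots *)

Lemma VY_roots_bounded (R : realType) (N : nat) (L : nat -> dpoly (Cplx R))
    (Q : nat -> {poly Cplx R}) :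
  (1 <= N)%N -> is_lenard L -> is_higher_VY N L Q ->
  exists2 r : R, 0 < r & forall n, (1 <= n)%N ->
    scaled_roots N Q n `<=` disk r.
Proof.
move=> N1 hL hQ.
(* [expR 8] serves twice: q^(2m) <= e^8 in the size of the potential, and q^m <= e^4 <= e^8 in the
   bound of [theta * q ^+ m] by [lam * mu]. *)
have [C C0 hC] := lenard_jetw_bound R L N (expR 8) N hL (expR_ge0 _).
pose sigma : R := 2 ^+ N.*2.+3.
pose g := vy_gap N : R; have g0 : 0 < g by exact: vy_gap_gt0.
pose c := 16 * C * sigma ^+ N.*2.
have s0 : 0 < sigma by rewrite exprn_gt0.
have c0 : 0 <= c.
  by apply: mulr_ge0; [exact: mulr_ge0|rewrite exprn_ge0// ltW].
(* With [eta] = c / t^(2N+1), the summands give t >= 1, then [eta] <= 1/16, then 8 [eta] <= g for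
   every t >= r. *)
pose r := 1 + c * (16 + 8 / g).
have h8 : 0 <= 8 / g by rewrite divr_ge0// ltW.
have r1 : 1 <= r by rewrite /r lerDl mulr_ge0 ?addr_ge0.
have r0 : 0 < r by apply: lt_le_trans r1.
exists r => // n n1 y /= /rootP Qy; rewrite /disk /= ltNge; apply/negP => ry.
set s : R := n%:R `^ _ in Qy.
have nn : 0 < n%:R :> R by rewrite ltr0n.
have sp : 0 < s by exact: powR_gt0.
have sE : s ^+ N.*2.+1 = n%:R ^+ N.*2.
  rewrite /s -powR_mulrn ?powR_ge0// -powRrM divfK ?pnatr_eq0//.
  by rewrite powR_mulrn.
pose t := cnorm y; pose rho := s * t.
have t1 : 1 <= t by exact: le_trans ry.
have t0 : 0 < t by apply: lt_le_trans t1.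
have rho0 : 0 < rho by exact: mulr_gt0.
have rhoE : rho = cnorm (toC s * y) by rewrite cnormM cnorm_toC ?ltW.
pose theta := sigma / rho; pose mu : R := n%:R^-1; pose lam := n%:R * theta.
have theta0 : 0 < theta by exact: divr_gt0.
have theta_rho : theta * rho = sigma by rewrite divfK// gt_eqF.
have mu01 : 0 <= mu <= 1.
  by rewrite invr_ge0 ler0n invf_le1 ?ler1n.
have lam0 : 0 <= lam by rewrite mulr_ge0 ?ltW.
have lam_mu : lam * mu = theta by rewrite /lam /mu mulrAC divff ?mul1r ?gt_eqF.
pose eta := 16 * C * lam ^+ N.*2 / rho.
have etaE : eta = c / t ^+ N.*2.+1.
  rewrite /eta; have -> : lam ^+ N.*2 = n%:R ^+ N.*2 * sigma ^+ N.*2 / rho ^+ N.*2.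
    by rewrite /lam /theta [LHS]exprMn expr_div_n mulrA.
  rewrite /c -sE /rho [(s * t) ^+ _]exprMn (exprS s) (exprS t).
  have su : s ^+ N.*2 != 0 by rewrite expf_neq0 ?gt_eqF.
  have tu : t ^+ N.*2 != 0 by rewrite expf_neq0 ?gt_eqF.
  have su' : s != 0 by rewrite gt_eqF.
  have tu' : t != 0 by rewrite gt_eqF.
  move: (s ^+ N.*2) (t ^+ N.*2) su tu (sigma ^+ _) => a b a0 b0 w.
  by field; rewrite a0 b0 su' tu'.
have tN : t <= t ^+ N.*2.+1 by rewrite exprS ler_peMr ?(ltW t0)// exprn_ege1.
have key (d : R) : 0 < d -> c / d <= t -> eta <= d.
  move=> d0 h; rewrite etaE ler_pdivrMr ?exprn_gt0// -ler_pdivrMl// mulrC.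
  exact: le_trans tN.
have e16 : eta <= 16^-1.
  apply: key; rewrite ?invr_gt0// invrK; apply: le_trans ry.
  have : 0 <= c * (8 / g) by rewrite mulr_ge0.
  by rewrite /r mulrDr; lra.
have eg : 8 * eta <= g.
  rewrite mulrC -ler_pdivlMr//; apply: key; rewrite ?divr_gt0// invf_div.
  apply: le_trans ry; rewrite /r mulrDr.
  have : 0 <= c * 16 by rewrite mulr_ge0.
  by lra.
have hC' la ka mu' s' a b d e f j jN := hC la ka mu' s' a b d e f j jN.
(* Here M = n, that is [mu] = 1/n, and the index m = n is the last one with m mu <= 1. *)
have [] := vy_majorized N rho theta mu lam (expR (4 * mu)) N1 rho0 theta_rho mu01
  lam0 lam_mu erefl L Q C (toC s * y) hQ C0 rhoE hC' e16 eg n _.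
  by rewrite mulfV ?gt_eqF.
by rewrite Qy eqxx.
Qed.

Theorem theorem1p5 (R : realType) (N : nat) (hN : (1 <= N)%N)
    (L : nat -> dpoly (Cplx R)) (hL : is_lenard L)
    (Q : nat -> {poly Cplx R}) (hQ : is_higher_VY N L Q) :
  exists P : set (Cplx R),
    compact_region P /\
    forall delta : R, 0 < delta ->
      \forall n \near \oo, scaled_roots N Q n `<=` nbhd_of P delta.
Proof.
have [r r0 hr] := VY_roots_bounded R N L Q hN hL hQ.
exists (closure (disk r)); split; first exact: compact_region_closure_disk.
move=> delta d0; exists 1%N => // n /= n1 x /(hr n n1) xr.
(* The scaled roots already lie in the region, so x itself is a point of it at distance 0. *)
exists x; first exact: subset_closure.
by rewrite subrr normr0 -toC0 toC_lt.
Qed.
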